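(* Let $R$, $I=(\phi_1,\dots,\phi_n)$, $\sigma=(1\le\sigma_1<\dots<\sigma_t\le n)$, $F_\bullet$ be as in the context. Assume that $F_\bullet$ is in standard form of class $H(p,q)$ with $f_1^i\cdot_Ff_1^j\in\mathfrak m^2F_2$ for all $i,j\ne p+1$, and that $d_2(F_2)\subseteq\mathfrak m^2F_1$. Then $\operatorname{tm}_\sigma(I)$ is either Golod (i.e. defines a Golod ring) or defines a ring of Tor-algebra class $H(p-|\sigma\cap[p]|,q)$, where $[p]=\{1,\dots,p\}$.
   Context: Setting. $(R,\mathfrak m,k)$ is a regular local ring of dimension $3$; $I=(\phi_1,\dots,\phi_n)\subseteq R$ is an ideal with $\operatorname{pd}_R(R/I)=3$. $(F_\bullet,d_\bullet)$ is a minimal DG-algebra (associative, graded-commutative) free resolution of $R/I$, with product written $\cdot_F$. The basis $f_1^1,\dots,f_1^n$ of $F_1$ satisfies $d_1(f_1^i)=\phi_i$. ''An ideal defines a ring of class X'' means the quotient of $R$ by that ideal has that property. Trimming: $\operatorname{tm}_\sigma(I):=(\phi_i\mid i\notin\sigma)+\mathfrak m(\phi_j\mid j\in\sigma)$. Tor-algebra class: for an ideal $I$ with $\operatorname{pd}_R(R/I)=3$, $R/I$ has class $H(p,q)$ if there are bases $\{\overline{f_1^i}\},\{\overline{f_2^i}\},\{\overline{f_3^i}\}$ of $\operatorname{Tor}_1^R(R/I,k),\operatorname{Tor}_2^R(R/I,k),\operatorname{Tor}_3^R(R/I,k)$ in which the only nonzero products of basis elements in positive degrees (up to graded commutativity)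 are $\overline{f_1^{p+1}}\,\overline{f_1^i}=\overline{f_2^i}$ for $1\le i\le p$ and $\overline{f_1^{p+1}}\,\overline{f_2^{p+i}}=\overline{f_3^i}$ for $1\le i\le q$. The DG-algebra resolution $F_\bullet$ is in standard form of class $H(p,q)$ if it has bases $\{f_1^i\},\{f_2^i\},\{f_3^i\}$ whose images in $F_\bullet\otimes_Rk=\operatorname{Tor}^R_\bullet(R/I,k)$ have this multiplication table. (For quotients of projective dimension $3$, being Golod is equivalent to triviality of the multiplication on $\operatorname{Tor}_+^R(R/I,k)$.) *)

(* Defs.v *)
From HB Require Import structures.
From mathcomp Require Import all_boot all_order all_algebra.
From mathcomp Require Import boolp classical_sets.
Set Implicit Arguments.
Unset Strict Implicit.
Unset Printing Implicit Defensive.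
Import GRing.Theory.
Local Open Scope classical_set_scope.
Local Open Scope ring_scope.

Section Ideals.
Variable R : comNzRingType.
Implicit Types I J P m : set R.

Definition is_ideal J : Prop :=
  [/\ J 0, forall x y, J x -> J y -> J (x + y) & forall a x, J x -> J (a * x)].

Definition ideal_gen (S : set R) : set R :=
  [set r | exists (n : nat) (c s : 'I_n -> R),
             (forall i, S (s i)) /\ r = \sum_i c i * s i].

Definition idealD I J : set R := [set r | exists x y, [/\ I x, J y & r = x + y]].

Definition idealM I J : set R :=
  ideal_gen [set r | exists x y, [/\ I x, J y & r = x * y]].

Definition prime_ideal P : Prop :=
  [/\ is_ideal P, ~ P 1 & forall x y, P (x * y) -> P x \/ P y].

Definition maximal_ideal m : Prop :=
  [/\ is_ideal m, ~ m 1
    & forall J, is_ideal J -> ~ J 1 -> m `<=` J -> J = m].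

Definition noetherian : Prop :=
  forall J, is_ideal J -> exists (n : nat) (g : 'I_n -> R), J = ideal_gen (range g).

Definition local_ring m : Prop :=
  maximal_ideal m /\ forall m', maximal_ideal m' -> m' = m.

Definition prime_chain (d : nat) : Prop :=
  exists P : nat -> set R,
    (forall i, (i <= d)%N -> prime_ideal (P i)) /\
    (forall i, (i < d)%N -> P i `<` P i.+1).

Definition krull_dim (d : nat) : Prop :=
  prime_chain d /\ forall d', prime_chain d' -> (d' <= d)%N.

Definition regular_local_ring m (d : nat) : Prop :=
  [/\ noetherian, local_ring m, krull_dim d
    & exists x : 'I_d -> R, m = ideal_gen (range x)].

Definition trimming m (n : nat) (phi : 'I_n -> R) (sigma : {set 'I_n}) : set R :=
  idealD (ideal_gen (phi @` [set i | i \notin sigma]))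
         (idealM m (ideal_gen (phi @` [set j | j \in sigma]))).

(* The submodule J F of a free module F. *)
Definition in_ideal_mul J (n : nat) (v : 'rV[R]_n) : Prop := forall j, J (v 0 j).

Definition is_basis (N n : nat) (f : 'I_n -> 'rV[R]_N) : Prop :=
  forall v : 'rV[R]_N, exists! c : 'rV[R]_n, v = \sum_i c 0 i *: f i.

End Ideals.

(* The module in degree i is 'rV[R]_(rk i) and the differential acts by right
   multiplication.  Since 0.-1 = 0, [dif 0] is an endomorphism of the degree 0
   part; resolutions and DG algebras require it to be 0. *)

Record free_complex (R : comNzRingType) := FreeComplex {
  rk : nat -> nat;
  dif : forall i, 'M[R]_(rk i, rk i.-1)
}.

(* [C] together with the free generator [e] of C_0 resolves R/J: C_0 = R e, and
   R/J is the cokernel of the differential C_1 -> C_0. *)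
Definition resolution (R : comNzRingType) (C : free_complex R) (e : 'rV[R]_(rk C 0))
    (J : set R) : Prop :=
  [/\ dif C 0 = 0,
      forall i, dif C i.+1 *m dif C i = 0,
      forall v : 'rV[R]_(rk C 0), exists! r : R, v = r *: e,
      forall r, J r <-> exists y : 'rV[R]_(rk C 1), y *m dif C 1 = r *: e
    & forall i (v : 'rV[R]_(rk C i.+1)), v *m dif C i.+1 = 0 ->
        exists w : 'rV[R]_(rk C i.+2), v = w *m dif C i.+2].

(* Projective dimension of R/J, for R local Noetherian (so that finitely
   generated projectives are free) and d > 0 (so that C_0 = R is no
   restriction). *)
Definition pd_quotient_le (R : comNzRingType) (J : set R) (d : nat) : Prop :=
  exists (C : free_complex R) (e : 'rV[R]_(rk C 0)),
    resolution e J /\ forall i, (d < i)%N -> rk C i = 0%N.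

Definition pd_quotient (R : comNzRingType) (J : set R) (d : nat) : Prop :=
  pd_quotient_le J d /\ forall d', pd_quotient_le J d' -> (d <= d')%N.

(* [tbl i j l a b] is the degree l component of the product of the a-th basis
   vector in degree i and the b-th one in degree j.  Keeping the target degree l
   as a separate argument avoids transports along equations such as
   i + (j + k) = (i + j) + k; [tbl i j l] vanishes unless l = i + j. *)

Record dg_data (R : comNzRingType) := DGData {
  dg_complex :> free_complex R;
  tbl : forall i j l, 'I_(rk dg_complex i) -> 'I_(rk dg_complex j) ->
          'rV[R]_(rk dg_complex l);
  dg_one : 'rV[R]_(rk dg_complex 0)
}.

Definition dg_mul (R : comNzRingType) (A : dg_data R) (i j l : nat)
    (x : 'rV[R]_(rk A i)) (y : 'rV[R]_(rk A j)) : 'rV[R]_(rk A l) :=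
  \sum_a \sum_b (x 0 a * y 0 b) *: tbl l a b.
Arguments dg_mul {R} A {i j} l x y.

Record is_dg_algebra (R : comNzRingType) (A : dg_data R) : Prop := IsDGAlgebra {
  dg_dif0 : dif A 0 = 0;
  dg_difK : forall i, dif A i.+1 *m dif A i = 0;
  dg_graded : forall i j l (x : 'rV[R]_(rk A i)) (y : 'rV[R]_(rk A j)),
    l <> (i + j)%N -> dg_mul A l x y = 0;
  dg_mul1l : forall i (x : 'rV[R]_(rk A i)), dg_mul A i (dg_one A) x = x;
  dg_mulA : forall i j k (x : 'rV[R]_(rk A i)) (y : 'rV[R]_(rk A j))
      (z : 'rV[R]_(rk A k)),
    dg_mul A (i + j + k) (dg_mul A (i + j) x y) z =
    dg_mul A (i + j + k) x (dg_mul A (j + k) y z);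
  dg_mulC : forall i j (x : 'rV[R]_(rk A i)) (y : 'rV[R]_(rk A j)),
    dg_mul A (i + j) x y = (-1) ^+ (i * j) *: dg_mul A (i + j) y x;
  dg_mul_odd : forall i (x : 'rV[R]_(rk A i)), odd i -> dg_mul A (i + i) x x = 0;
  dg_leibniz : forall i j (x : 'rV[R]_(rk A i)) (y : 'rV[R]_(rk A j)),
    dg_mul A (i + j) x y *m dif A (i + j) =
    dg_mul A (i + j).-1 (x *m dif A i) y
      + (-1) ^+ i *: dg_mul A (i + j).-1 x (y *m dif A j)
}.

Definition dg_resolution (R : comNzRingType) (F : dg_data R) (J : set R) : Prop :=
  is_dg_algebra F /\ resolution (dg_one F) J.

Definition minimal (R : comNzRingType) (m : set R) (C : free_complex R) : Prop :=
  forall i (v : 'rV[R]_(rk C i)), in_ideal_mul m (v *m dif C i).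

Definition base_change (R S : comNzRingType) (f : {rmorphism R -> S})
    (A : dg_data R) : dg_data S :=
  @DGData S (@FreeComplex S (rk A) (fun i => map_mx f (dif A i)))
    (fun i j l a b => map_mx f (tbl l a b)) (map_mx f (dg_one A)).

Section Homology.
Variables (k : fieldType) (A : dg_data k).

Definition homologous (l : nat) (x y : 'rV[k]_(rk A l)) : Prop :=
  exists w : 'rV[k]_(rk A l.+1), x - y = w *m dif A l.+1.

Definition homology_basis (l n : nat) (z : 'I_n -> 'rV[k]_(rk A l)) : Prop :=
  (forall a, z a *m dif A l = 0) /\
  forall v : 'rV[k]_(rk A l), v *m dif A l = 0 ->
    exists! c : 'rV[k]_n, homologous v (\sum_a c 0 a *: z a).

(* Indices start at 0: the element written f_1^(p+1) is [z1 p]. *)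
Definition table_H (p q n1 n2 n3 : nat) (z1 : 'I_n1 -> 'rV[k]_(rk A 1))
    (z2 : 'I_n2 -> 'rV[k]_(rk A 2)) (z3 : 'I_n3 -> 'rV[k]_(rk A 3)) : Prop :=
  [/\ [/\ (p < n1)%N, (p + q <= n2)%N & (q <= n3)%N],
      forall (i j : 'I_n1) (l : 'I_n2), i = p :> nat -> (j < p)%N ->
        l = j :> nat ->
        homologous (dg_mul A 2 (z1 i) (z1 j)) (z2 l),
      forall i j : 'I_n1, ~ (i = p :> nat /\ (j < p)%N) ->
        ~ (j = p :> nat /\ (i < p)%N) ->
        homologous (dg_mul A 2 (z1 i) (z1 j)) 0,
      forall (i : 'I_n1) (j : 'I_n2) (l : 'I_n3), i = p :> nat -> (l < q)%N ->
        j = (p + l)%N :> nat ->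
        homologous (dg_mul A 3 (z1 i) (z2 j)) (z3 l)
    & forall (i : 'I_n1) (j : 'I_n2),
        ~ (i = p :> nat /\ (p <= j < p + q)%N) ->
        homologous (dg_mul A 3 (z1 i) (z2 j)) 0].

(* Words in a homogeneous basis of the positive-degree homology; the letter
   (i, a) stands for the a-th basis element of degree i.+1.  The value of a
   Massey operation at h_1 ... h_s has degree |h_1| + ... + |h_s| + s - 1. *)
Definition massey_deg (h : nat -> nat) (w : seq {i : nat & 'I_(h i)}) : nat :=
  (\sum_(c <- w) (tag c).+2)%N.-1.

(* Only the component of [mu w] in degree [massey_deg w] is meaningful. *)
Definition trivial_massey_operation : Prop :=
  exists (h : nat -> nat) (z : forall i, 'I_(h i) -> 'rV[k]_(rk A i.+1))
    (mu : seq {i : nat & 'I_(h i)} -> forall l, 'rV[k]_(rk A l)),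
  [/\ forall i, homology_basis (z i),
      forall i (a : 'I_(h i)), mu [:: Tagged (fun i => 'I_(h i)) a] i.+1 = z i a
    & forall w, (1 < size w)%N ->
        mu w (massey_deg w) *m dif A (massey_deg w) =
        \sum_(1 <= j < size w)
          (-1) ^+ (massey_deg (take j w)).+1 *:
          dg_mul A (massey_deg w).-1
            (mu (take j w) (massey_deg (take j w)))
            (mu (drop j w) (massey_deg (drop j w)))].

End Homology.

(* Here [pi : R -> k] is the residue map of R.  Tor^R(R/J, k) is the homology
   algebra of F (x) k, where F is any DG-algebra free resolution of R/J; as an
   algebra it does not depend on F. *)

Section Classes.
Variables (R : comNzRingType) (k : fieldType) (pi : {rmorphism R -> k}).

Definition tor_class_H (J : set R) (p q : nat) : Prop :=
  pd_quotient J 3 /\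
  exists F : dg_data R, dg_resolution F J /\
  exists (n1 n2 n3 : nat)
    (z1 : 'I_n1 -> 'rV[k]_(rk (base_change pi F) 1))
    (z2 : 'I_n2 -> 'rV[k]_(rk (base_change pi F) 2))
    (z3 : 'I_n3 -> 'rV[k]_(rk (base_change pi F) 3)),
    [/\ homology_basis z1, homology_basis z2, homology_basis z3
      & table_H p q z1 z2 z3].

(* R/J is Golod: R being regular, for J contained in m^2 the DG algebra F (x) k
   is quasi-isomorphic to the Koszul complex of R/J on a minimal generating set
   of its maximal ideal, and either one admits a trivial Massey operation iff
   the other does. *)
Definition defines_golod (m J : set R) : Prop :=
  J `<=` idealM m m /\
  exists F : dg_data R, dg_resolution F J /\
    trivial_massey_operation (base_change pi F).

Definition standard_form_H (F : dg_data R) (p q n1 n2 n3 : nat)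
    (f1 : 'I_n1 -> 'rV[R]_(rk F 1)) (f2 : 'I_n2 -> 'rV[R]_(rk F 2))
    (f3 : 'I_n3 -> 'rV[R]_(rk F 3)) : Prop :=
  [/\ is_basis f1, is_basis f2, is_basis f3
    & @table_H k (base_change pi F) p q n1 n2 n3
        (fun i => map_mx pi (f1 i)) (fun i => map_mx pi (f2 i))
        (fun i => map_mx pi (f3 i))].

End Classes.

(* Main.v *)
Require Import Defs.
From HB Require Import structures.
From mathcomp Require Import all_boot all_order all_algebra.
From mathcomp Require Import boolp classical_sets.
From mathcomp Require Import ring.
Import GRing.Theory.
Set Implicit Arguments.
Unset Strict Implicit.
Unset Printing Implicit Defensive.
Local Open Scope classical_set_scope.
Local Open Scope ring_scope.

(* Write m = (x1, x2, x3). Since pd R/I = 3, the Koszul complex K on x is exact: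
   a diagram chase in K (x) F shows it, m annihilating the homology of K and
   F_4 = 0. Consequently, the x_i are independent modulo m^2.

   The trimming complex T has T_1 = R^(~sigma) + K_1^sigma, T_2 = F_2 + K_2^sigma
   and T_3 = F_3 + K_3^sigma. It surjects onto the DG subalgebra of F that is
   generated in degree 1 by the f_1^i (i notin sigma) and m f_1^j (j in sigma)
   and equals F in degrees 2 and 3. The map d_2 lifts to Q : F_2 -> T_1 with
   entries in m because d_2 F_2 is in m^2 F_1, so T is minimal.
   The product of F lifts to T_1 x T_1 -> T_2 because K is exact, then extends
   to a DG algebra structure because T is exact. When a product in F vanishes
   modulo m, the differential of the Koszul component of its lift lies in m^2 K,
   so this component vanishes modulo m by independence of the x_i. Hence a product
   of basis elements of T is nonzero modulo m only when it involves f_1^(p+1) and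
   lifts a nonzero product of F: none is left if p + 1 is in sigma, and otherwise,
   with Koszul components added to f_2 and f_3, they give H(p', q), p' being the
   number of i <= p outside sigma. *)

(** * Minimal resolutions *)

Section MinimalResolutions.
Variables (R : comNzRingType) (k : fieldType) (pi : {rmorphism R -> k}).

Lemma mx_factor a b c (A : 'M[R]_(a, c)) (B : 'M[R]_(b, c)) :
  (forall i, exists w : 'rV_b, row i A = w *m B) -> exists W, A = W *m B.
Proof.
move=> /fin_all_exists[w hw]; exists (\matrix_i w i).
by apply/row_matrixP => i; rewrite row_mul rowK.
Qed.

Lemma dim0_of_1mx0 n : (1%:M : 'M[k]_n) = 0 -> n = 0%N.
Proof.
case: n => // n /matrixP/(_ ord0 ord0)/eqP.
by rewrite !mxE eqxx oner_eq0.
Qed.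

Lemma minimal_dif_eq0 (m : set R) (C : free_complex R) i :
  (forall r, m r -> pi r = 0) -> minimal m C -> map_mx pi (dif C i) = 0.
Proof.
move=> hm hC; apply/matrixP => a b; rewrite !mxE; apply: hm.
by have := hC i (delta_mx 0 a) b; rewrite -rowE mxE.
Qed.

(** [C_0] is free on [eC], but its presentation as row vectors does not exhibit rank 1. A column
    matrix gives the coordinate along [eC] linearly, ready for use in matrix products. *)
Lemma degree0_coord (C : free_complex R) eC J : @resolution R C eC J ->
  exists c : 'cV[R]_(rk C 0), forall v : 'rV_(rk C 0), v = (v *m c) 0 0 *: eC.
Proof.
move=> [_ _ hC _ _].
have /fin_all_exists[r hr] : forall i, exists r : R, row i 1%:M = r *: eC.
  by move=> i; have [r []] := hC (row i 1%:M); exists r.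
exists (\col_i r i) => v; rewrite -{1}[v]mulmx1 mulmx_sum_row mxE scaler_suml.
by apply: eq_bigr => i _; rewrite hr scalerA mxE.
Qed.

Lemma degree0_free (C : free_complex R) eC J (r s : R) :
  @resolution R C eC J -> r *: eC = s *: eC -> r = s.
Proof.
move=> [_ _ hC _ _] h; have [u [_ hu]] := hC (r *: eC).
by rewrite -(hu r) // -(hu s).
Qed.

Lemma degree0_map (C D : free_complex R) eC eD J :
    @resolution R C eC J -> @resolution R D eD J ->
  exists A : 'M[R]_(rk C 0, rk D 0), eC *m A = eD.
Proof.
move=> hC _; have [c hc] := degree0_coord hC; exists (c *m eD).
rewrite mulmxA [eC *m c]mx11_scalar mul_scalar_mx.
suff -> : (eC *m c) 0 0 = 1 by rewrite scale1r.
by apply: (degree0_free hC); rewrite -hc scale1r.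
Qed.

Lemma degree0_ext (C : free_complex R) eC J n (A B : 'M[R]_(rk C 0, n)) :
  @resolution R C eC J -> eC *m A = eC *m B -> A = B.
Proof.
move=> [_ _ hC _ _] hAB; apply/row_matrixP => i; rewrite !rowE.
by have [r [-> _]] := hC (delta_mx 0 i); rewrite -!scalemxAl hAB.
Qed.

Lemma resolution_factor (C : free_complex R) eC J i n
    (A : 'M[R]_(n, rk C i.+1)) :
  @resolution R C eC J -> A *m dif C i.+1 = 0 ->
  exists W, A = W *m dif C i.+2.
Proof.
move=> [_ _ _ _ ex] hA; apply: mx_factor => j; apply: ex.
by rewrite -row_mul hA row0.
Qed.

Lemma degree1_map (C D : free_complex R) eC eD J (A : 'M[R]_(rk C 0, rk D 0)) :
    @resolution R C eC J -> @resolution R D eD J -> eC *m A = eD ->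
  exists B : 'M[R]_(rk C 1, rk D 1), dif C 1 *m A = B *m dif D 1.
Proof.
move=> [_ _ hC hCJ _] [_ _ _ hDJ _] hA; apply: mx_factor => i.
have [r [hr _]] := hC (row i (dif C 1)).
have /hDJ[y hy] : J r.
  by apply/hCJ; exists (delta_mx 0 i); rewrite -rowE.
by exists y; rewrite hy row_mul hr -scalemxAl hA.
Qed.

(** Comparison maps in both directions and a homotopy from 1 to their composite, kept in two
    consecutive degrees only: this window is all that the next step of the induction needs, so no
    infinite family of maps has to be chosen. *)
Lemma comparison (C D : free_complex R) eC eD J i :
    @resolution R C eC J -> @resolution R D eD J ->
  exists (a0 : 'M[R]_(rk C i, rk D i)) (b0 : 'M[R]_(rk D i, rk C i))
    (h0 : 'M[R]_(rk C i, rk C i.+1)) (a1 : 'M[R]_(rk C i.+1, rk D i.+1))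
    (b1 : 'M[R]_(rk D i.+1, rk C i.+1)) (h1 : 'M[R]_(rk C i.+1, rk C i.+2)),
  [/\ dif C i.+1 *m a0 = a1 *m dif D i.+1,
      dif D i.+1 *m b0 = b1 *m dif C i.+1
    & 1%:M - a1 *m b1 = h1 *m dif C i.+2 + dif C i.+1 *m h0].
Proof.
move=> hC hD; elim: i => [|i [a0 [b0 [h0 [a1 [b1 [h1 [ea eb eh]]]]]]]].
  have [a0 ha0] := degree0_map hC hD; have [b0 hb0] := degree0_map hD hC.
  have [a1 ha1] := degree1_map hC hD ha0; have [b1 hb1] := degree1_map hD hC hb0.
  have ab0 : a0 *m b0 = 1%:M.
    by apply: (degree0_ext hC); rewrite mulmxA ha0 hb0 mulmx1.
  have [h1 hh1] : exists W, 1%:M - a1 *m b1 = W *m dif C 2.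
    apply: (resolution_factor hC).
    by rewrite mulmxBl mul1mx -mulmxA -hb1 mulmxA -ha1 -mulmxA ab0 mulmx1 subrr.
  (* The homotopy starts with 0, because the composite is already the identity in degree 0. *)
  by exists a0, b0, 0, a1, b1, h1; split; rewrite ?ha1 ?hb1 // mulmx0 addr0.
have [[_ CC _ _ _] [_ DD _ _ _]] := (hC, hD).
have [a2 ha2] : exists W, dif C i.+2 *m a1 = W *m dif D i.+2.
  by apply: (resolution_factor hD); rewrite -mulmxA -ea mulmxA CC mul0mx.
have [b2 hb2] : exists W, dif D i.+2 *m b1 = W *m dif C i.+2.
  by apply: (resolution_factor hC); rewrite -mulmxA -eb mulmxA DD mul0mx.
have [h2 hh2] : exists W,
    1%:M - a2 *m b2 - dif C i.+2 *m h1 = W *m dif C i.+3.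
  apply: (resolution_factor hC).
  rewrite !mulmxBl mul1mx -mulmxA -hb2 mulmxA -ha2 -!mulmxA.
  have -> : h1 *m dif C i.+2 = 1%:M - a1 *m b1 - dif C i.+1 *m h0.
    by rewrite eh addrK.
  rewrite !mulmxBr mulmx1 !(mulmxA (dif C i.+2) (dif C i.+1)).
  by rewrite CC mul0mx subr0 subrr.
exists a1, b1, h1, a2, b2, h2; split=> //.
by rewrite -hh2 subrK.
Qed.

(** The composite through [D] is 0 in degree [d.+1], so the identity of [C] equals the homotopy
    terms there. These contain differentials of [C] and vanish over [k], and a vector space whose
    identity is 0 has dimension 0. *)
Lemma minimal_resolution_rk (C D : free_complex R) eC eD J d :
    @resolution R C eC J -> @resolution R D eD J ->
    (forall i, map_mx pi (dif C i) = 0) -> rk D d.+1 = 0%N ->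
  rk C d.+1 = 0%N.
Proof.
move=> hC hD hmin hd.
have [a0 [b0 [h0 [a1 [b1 [h1 [_ _ eh]]]]]]] := comparison d hC hD.
have ab0 : a1 *m b1 = 0.
  by move: (a1) (b1); rewrite hd => u v; rewrite thinmx0 mul0mx.
apply: dim0_of_1mx0; rewrite -[LHS](map_mx1 pi).
move: eh; rewrite ab0 subr0 => ->.
by rewrite map_mxD !map_mxM /= !hmin mulmx0 mul0mx addr0.
Qed.

Lemma minimal_resolution_rk_eq0 (C : free_complex R) eC J d :
    @resolution R C eC J -> (forall i, map_mx pi (dif C i) = 0) ->
    pd_quotient_le J d ->
  forall i, (d < i)%N -> rk C i = 0%N.
Proof.
move=> hC hmin [D [eD [hD hd]]] [//|i] hi.
by apply: (minimal_resolution_rk hC hD hmin); apply: hd.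
Qed.

End MinimalResolutions.

(** * The Koszul complex on generators of m *)

Section Koszul.
Variables (R : comNzRingType) (x1 x2 x3 : R).

(* Exactness of the Koszul complex with matrix coefficients in degrees 3, 2 and
   1, its differentials being multiplication by the vector x, cross product and
   scalar product with x. *)
Definition koszul_inj a b := forall V : 'M[R]_(a, b),
  x1 *: V = 0 -> x2 *: V = 0 -> x3 *: V = 0 -> V = 0.

Definition koszul_grad a b := forall V1 V2 V3 : 'M[R]_(a, b),
  x2 *: V3 = x3 *: V2 -> x3 *: V1 = x1 *: V3 -> x1 *: V2 = x2 *: V1 ->
  exists W, [/\ V1 = x1 *: W, V2 = x2 *: W & V3 = x3 *: W].

Definition koszul_curl a b := forall V1 V2 V3 : 'M[R]_(a, b),
  x1 *: V1 + x2 *: V2 + x3 *: V3 = 0 ->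
  exists W1 W2 W3,
    [/\ V1 = x2 *: W3 - x3 *: W2, V2 = x3 *: W1 - x1 *: W3
      & V3 = x1 *: W2 - x2 *: W1].

Definition koszul_exact a b :=
  [/\ koszul_inj a b, koszul_grad a b & koszul_curl a b].

Section Entrywise.
Variables (a b : nat).

Lemma koszul_injW :
  (forall z, x1 * z = 0 -> x2 * z = 0 -> x3 * z = 0 -> z = 0) -> koszul_inj a b.
Proof.
move=> h V h1 h2 h3; apply/matrixP => i j; rewrite mxE.
by apply: h; [move/matrixP/(_ i j): h1|move/matrixP/(_ i j): h2|
  move/matrixP/(_ i j): h3]; rewrite !mxE.
Qed.

Lemma koszul_gradW :
  (forall z1 z2 z3, x2 * z3 = x3 * z2 -> x3 * z1 = x1 * z3 ->
     x1 * z2 = x2 * z1 ->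
     exists w, [/\ z1 = x1 * w, z2 = x2 * w & z3 = x3 * w]) -> koszul_grad a b.
Proof.
move=> h V1 V2 V3 h1 h2 h3.
have /fin_all_exists[w hw] : forall ij : 'I_a * 'I_b, exists w : R,
    [/\ V1 ij.1 ij.2 = x1 * w, V2 ij.1 ij.2 = x2 * w & V3 ij.1 ij.2 = x3 * w].
  move=> [i j]; apply: h; [move/matrixP/(_ i j): h1|move/matrixP/(_ i j): h2|
    move/matrixP/(_ i j): h3]; by rewrite !mxE.
exists (\matrix_(i, j) w (i, j)).
by split; apply/matrixP => i j; rewrite !mxE; have [] := hw (i, j).
Qed.

Lemma koszul_curlW :
  (forall z1 z2 z3, x1 * z1 + x2 * z2 + x3 * z3 = 0 ->
     exists w1 w2 w3,
       [/\ z1 = x2 * w3 - x3 * w2, z2 = x3 * w1 - x1 * w3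
         & z3 = x1 * w2 - x2 * w1]) -> koszul_curl a b.
Proof.
move=> h V1 V2 V3 h1.
have /fin_all_exists[w hw] : forall ij : 'I_a * 'I_b, exists w : R * R * R,
    [/\ V1 ij.1 ij.2 = x2 * w.2 - x3 * w.1.2,
        V2 ij.1 ij.2 = x3 * w.1.1 - x1 * w.2
      & V3 ij.1 ij.2 = x1 * w.1.2 - x2 * w.1.1].
  move=> [i j]; have [|w1 [w2 [w3 hw]]] := h (V1 i j) (V2 i j) (V3 i j).
    by move/matrixP/(_ i j): h1; rewrite !mxE.
  by exists (w1, w2, w3).
exists (\matrix_(i, j) (w (i, j)).1.1), (\matrix_(i, j) (w (i, j)).1.2),
  (\matrix_(i, j) (w (i, j)).2).
by split; apply/matrixP => i j; rewrite !mxE; have [] := hw (i, j).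
Qed.

End Entrywise.

Variables (k : fieldType) (pi : {rmorphism R -> k}).
Hypothesis pi_ker : forall r,
  pi r = 0 <-> exists c1 c2 c3, r = x1 * c1 + x2 * c2 + x3 * c3.

Lemma map_mx_eq0 a b (A : 'M[R]_(a, b)) : map_mx pi A = 0 ->
  exists A1 A2 A3, A = x1 *: A1 + x2 *: A2 + x3 *: A3.
Proof.
move=> hA.
have /fin_all_exists[w hw] : forall ij : 'I_a * 'I_b, exists w : R * R * R,
    A ij.1 ij.2 = x1 * w.1.1 + x2 * w.1.2 + x3 * w.2.
  move=> [i j]; have /pi_ker[c1 [c2 [c3 ->]]] : pi (A i j) = 0.
    by move/matrixP/(_ i j): hA; rewrite !mxE.
  by exists (c1, c2, c3).
exists (\matrix_(i, j) (w (i, j)).1.1), (\matrix_(i, j) (w (i, j)).1.2),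
  (\matrix_(i, j) (w (i, j)).2).
by apply/matrixP => i j; rewrite !mxE; have := hw (i, j).
Qed.

Section Chase.
Variables (N0 N1 N2 N3 : nat).
Variables (D1 : 'M[R]_(N1, N0)) (D2 : 'M[R]_(N2, N1)) (D3 : 'M[R]_(N3, N2)).
Hypotheses (D32 : D3 *m D2 = 0) (D21 : D2 *m D1 = 0).
Hypothesis ex1 : forall v : 'rV_N1, v *m D1 = 0 -> exists w, v = w *m D2.
Hypothesis ex2 : forall v : 'rV_N2, v *m D2 = 0 -> exists w, v = w *m D3.
Hypothesis inj3 : forall v : 'rV_N3, v *m D3 = 0 -> v = 0.
Hypothesis min3 : map_mx pi D3 = 0.
Variable i0 : 'I_N3.

Let f : 'rV[R]_N3 := delta_mx 0 i0.
Let v := f *m D3.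

(** Since [D3] is injective, the equality lifts to [z *: f = u], and [f] has coordinate 1 at [i0].
    Every chase ends this way. *)
Lemma chase_coef (z : R) (u : 'rV_N3) : z *: v = u *m D3 -> z = u 0 i0.
Proof.
move=> h; have /inj3/matrixP/(_ 0 i0) : (z *: f - u) *m D3 = 0.
  by rewrite mulmxBl -scalemxAl h subrr.
by rewrite !mxE !eqxx mulr1 => /eqP; rewrite subr_eq0 => /eqP.
Qed.

(* The three exactness statements are one diagram chase in the double complex
   K(x) (x) F. Since m kills the homology of K(x), a cycle z of positive degree
   gives a total cycle starting with z (x) f; exactness of F makes it a total
   boundary, which forces z to be a boundary because F_4 = 0. *)
Lemma chase_split : exists v1 v2 v3, v = x1 *: v1 + x2 *: v2 + x3 *: v3.
Proof. by apply: map_mx_eq0; rewrite map_mxM /= min3 mulmx0. Qed.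

Lemma chase_inj a b : koszul_inj a b.
Proof.
apply: koszul_injW => z h1 h2 h3; have [v1 [v2 [v3 ev]]] := chase_split.
rewrite (@chase_coef z 0) ?mxE // mul0mx ev !scalerDr !scalerA.
by rewrite !(mulrC z) h1 h2 h3 !scale0r !addr0.
Qed.

Lemma chase_vD2 : v *m D2 = 0.
Proof. by rewrite -mulmxA D32 mulmx0. Qed.

Lemma chase_grad a b : koszul_grad a b.
Proof.
apply: koszul_gradW => z1 z2 z3 h1 h2 h3; have [v1 [v2 [v3 ev]]] := chase_split.
(* The cycle conditions let z and x be exchanged in products [z_i x_j], so [z_i v = x_i w]: this is
   the first step of the zigzag. *)
pose w := z1 *: v1 + z2 *: v2 + z3 *: v3.
have e1 : z1 *: v = x1 *: w.
  rewrite ev !scalerDr !scalerA h3 -h2.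
  by rewrite (mulrC z1) (mulrC z1 x2) (mulrC z1).
have e2 : z2 *: v = x2 *: w.
  rewrite ev !scalerDr !scalerA -h3 h1.
  by rewrite (mulrC z2) (mulrC z2 x2) (mulrC z2).
have e3 : z3 *: v = x3 *: w.
  rewrite ev !scalerDr !scalerA -h1 h2.
  by rewrite (mulrC z3) (mulrC z3 x2) (mulrC z3).
(* Each [x_i] kills [w *m D2], because [x_i w = z_i v] and [v *m D2 = 0]; the injectivity already
   proved makes [w] a cycle of F. *)
have [u hu] : exists u, w = u *m D3.
  apply: ex2; apply: chase_inj; rewrite scalemxAl.
  - by rewrite -e1 -scalemxAl chase_vD2 scaler0.
  - by rewrite -e2 -scalemxAl chase_vD2 scaler0.
  - by rewrite -e3 -scalemxAl chase_vD2 scaler0.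
exists (u 0 i0); split.
- by rewrite (@chase_coef z1 (x1 *: u)) ?mxE // -scalemxAl -hu.
- by rewrite (@chase_coef z2 (x2 *: u)) ?mxE // -scalemxAl -hu.
- by rewrite (@chase_coef z3 (x3 *: u)) ?mxE // -scalemxAl -hu.
Qed.

Lemma chase_curl a b : koszul_curl a b.
Proof.
apply: koszul_curlW => z1 z2 z3 h; have [v1 [v2 [v3 ev]]] := chase_split.
(* W is the cross product of z with (v1, v2, v3). By the double cross product identity, x cross W
   equals z v up to a multiple of the scalar product of x and z, which is 0. *)
pose W1 := z2 *: v3 - z3 *: v2.
pose W2 := z3 *: v1 - z1 *: v3.
pose W3 := z1 *: v2 - z2 *: v1.
have e1 : z1 *: v = x2 *: W3 - x3 *: W2.
  apply/matrixP => i j; rewrite ev !mxE; apply/eqP; rewrite -subr_eq0; apply/eqP.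
  by rewrite -[RHS](mulr0 (v1 i j)) -h; ring.
have e2 : z2 *: v = x3 *: W1 - x1 *: W3.
  apply/matrixP => i j; rewrite ev !mxE; apply/eqP; rewrite -subr_eq0; apply/eqP.
  by rewrite -[RHS](mulr0 (v2 i j)) -h; ring.
have e3 : z3 *: v = x1 *: W2 - x2 *: W1.
  apply/matrixP => i j; rewrite ev !mxE; apply/eqP; rewrite -subr_eq0; apply/eqP.
  by rewrite -[RHS](mulr0 (v3 i j)) -h; ring.
have d0 z A B : z *: v = A - B -> A *m D2 = B *m D2.
  move=> /(congr1 (mulmx^~ D2)); rewrite -scalemxAl chase_vD2 scaler0 mulmxBl.
  by move/esym/eqP; rewrite subr_eq0 => /eqP.
(* The zigzag is one step longer here: [W *m D2] has zero curl, hence is x times some w; w is a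
   cycle, hence [u *m D2]; then [W - x u] is a cycle and comes from [F_3]. *)
have [w [w1 w2 w3]] : exists w,
    [/\ W1 *m D2 = x1 *: w, W2 *m D2 = x2 *: w & W3 *m D2 = x3 *: w].
  by apply: chase_grad; rewrite !scalemxAl;
    [exact: d0 e1|exact: d0 e2|exact: d0 e3].
have [u hu] : exists u, w = u *m D2.
  apply: ex1; apply: chase_inj; rewrite scalemxAl.
  - by rewrite -w1 -mulmxA D21 mulmx0.
  - by rewrite -w2 -mulmxA D21 mulmx0.
  - by rewrite -w3 -mulmxA D21 mulmx0.
have [U1 hU1] : exists U, W1 - x1 *: u = U *m D3.
  by apply: ex2; rewrite mulmxBl -scalemxAl w1 hu subrr.
have [U2 hU2] : exists U, W2 - x2 *: u = U *m D3.
  by apply: ex2; rewrite mulmxBl -scalemxAl w2 hu subrr.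
have [U3 hU3] : exists U, W3 - x3 *: u = U *m D3.
  by apply: ex2; rewrite mulmxBl -scalemxAl w3 hu subrr.
exists (U1 0 i0), (U2 0 i0), (U3 0 i0); split.
- rewrite (@chase_coef z1 (x2 *: U3 - x3 *: U2)) ?mxE //.
  rewrite e1 mulmxBl -!scalemxAl -hU2 -hU3.
  by apply/matrixP => i j; rewrite !mxE; ring.
- rewrite (@chase_coef z2 (x3 *: U1 - x1 *: U3)) ?mxE //.
  rewrite e2 mulmxBl -!scalemxAl -hU1 -hU3.
  by apply/matrixP => i j; rewrite !mxE; ring.
- rewrite (@chase_coef z3 (x1 *: U2 - x2 *: U1)) ?mxE //.
  rewrite e3 mulmxBl -!scalemxAl -hU1 -hU2.
  by apply/matrixP => i j; rewrite !mxE; ring.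
Qed.

Lemma chase_exact a b : koszul_exact a b.
Proof. by split; [exact: chase_inj|exact: chase_grad|exact: chase_curl]. Qed.

End Chase.

(* [in_sq A] says that the entries of A lie in m^2. *)
Definition in_sq a b (A : 'M[R]_(a, b)) := exists A1 A2 A3,
  [/\ A = x1 *: A1 + x2 *: A2 + x3 *: A3,
      map_mx pi A1 = 0, map_mx pi A2 = 0 & map_mx pi A3 = 0].

Lemma in_sq0 a b : in_sq (0 : 'M_(a, b)).
Proof. by exists 0, 0, 0; rewrite !scaler0 !addr0 map_mx0; split. Qed.

Lemma in_sqD a b (A B : 'M_(a, b)) : in_sq A -> in_sq B -> in_sq (A + B).
Proof.
move=> [A1 [A2 [A3 [-> a1 a2 a3]]]] [B1 [B2 [B3 [-> b1 b2 b3]]]].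
exists (A1 + B1), (A2 + B2), (A3 + B3).
rewrite !map_mxD a1 a2 a3 b1 b2 b3 !addr0; split=> //.
by apply/matrixP => i j; rewrite !mxE; ring.
Qed.

Lemma in_sqMl a b c (A : 'M_(a, b)) (B : 'M_(b, c)) :
  in_sq B -> in_sq (A *m B).
Proof.
move=> [B1 [B2 [B3 [-> b1 b2 b3]]]]; exists (A *m B1), (A *m B2), (A *m B3).
rewrite !map_mxM /= b1 b2 b3 !mulmx0; split=> //.
by rewrite !mulmxDr -!scalemxAr.
Qed.

Lemma in_sqMr a b c (A : 'M_(a, b)) (B : 'M_(b, c)) :
  in_sq A -> in_sq (A *m B).
Proof.
move=> [A1 [A2 [A3 [-> a1 a2 a3]]]]; exists (A1 *m B), (A2 *m B), (A3 *m B).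
rewrite !map_mxM /= a1 a2 a3 !mul0mx; split=> //.
by rewrite !mulmxDl -!scalemxAl.
Qed.

Lemma in_sqZ a b c (A : 'M_(a, b)) : in_sq A -> in_sq (c *: A).
Proof. by rewrite -mul_scalar_mx; apply: in_sqMl. Qed.

Lemma in_sqN a b (A : 'M_(a, b)) : in_sq A -> in_sq (- A).
Proof. by rewrite -scaleN1r; apply: in_sqZ. Qed.

Lemma in_sqB a b (A B : 'M_(a, b)) : in_sq A -> in_sq B -> in_sq (A - B).
Proof. by move=> hA hB; apply/in_sqD/in_sqN. Qed.

Lemma in_sq_sum a b (I : finType) (A : I -> 'M_(a, b)) :
  (forall i, in_sq (A i)) -> in_sq (\sum_i A i).
Proof.
move=> hA; elim/big_ind: _ => //; [exact: in_sq0|exact: in_sqD].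
Qed.

Lemma in_sqM a b c (A : 'M_(a, b)) (B : 'M_(b, c)) :
  map_mx pi A = 0 -> map_mx pi B = 0 -> in_sq (A *m B).
Proof.
move=> /map_mx_eq0[A1 [A2 [A3 ->]]] hB; exists (A1 *m B), (A2 *m B), (A3 *m B).
by rewrite !map_mxM /= hB !mulmx0 !mulmxDl -!scalemxAl; split.
Qed.

Lemma in_sqZ2 a b c (A : 'M_(a, b)) : pi c = 0 -> map_mx pi A = 0 -> in_sq (c *: A).
Proof.
move=> hc hA; rewrite -mul_scalar_mx; apply: in_sqM => //.
by rewrite map_scalar_mx /= hc -scalemx1 scale0r.
Qed.

Lemma pi_x : [/\ pi x1 = 0, pi x2 = 0 & pi x3 = 0].
Proof.
split; apply/pi_ker.
- by exists 1, 0, 0; ring.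
- by exists 0, 1, 0; ring.
- by exists 0, 0, 1; ring.
Qed.

Lemma in_sq_pi a b (A : 'M_(a, b)) : in_sq A -> map_mx pi A = 0.
Proof.
have [e1 e2 e3] := pi_x.
move=> [A1 [A2 [A3 [-> _ _ _]]]]; rewrite !map_mxD !map_mxZ /= e1 e2 e3.
by rewrite !scale0r !addr0.
Qed.

Section Independence.
Variables (a b : nat).
Hypothesis exK : koszul_exact a b.

(* As the syzygies of x have entries in m, the classes of the x_i are
   independent in m/m^2; in particular curl and grad reflect m^2. *)
Lemma in_sq_indep (V1 V2 V3 : 'M_(a, b)) :
  in_sq (x1 *: V1 + x2 *: V2 + x3 *: V3) ->
  [/\ map_mx pi V1 = 0, map_mx pi V2 = 0 & map_mx pi V3 = 0].
Proof.
have [e1 e2 e3] := pi_x; have [_ _ hcurl] := exK.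
move=> [A1 [A2 [A3 [h h1 h2 h3]]]].
have [W1 [W2 [W3 [E1 E2 E3]]]] : exists W1 W2 W3,
    [/\ V1 - A1 = x2 *: W3 - x3 *: W2, V2 - A2 = x3 *: W1 - x1 *: W3
      & V3 - A3 = x1 *: W2 - x2 *: W1].
  apply: hcurl; rewrite -[RHS](subrr (x1 *: A1 + x2 *: A2 + x3 *: A3)) -{1}h.
  by apply/matrixP => i j; rewrite !mxE; ring.
have key V A W W' y y' : pi y = 0 -> pi y' = 0 -> map_mx pi A = 0 ->
    V - A = y *: W - y' *: W' -> map_mx pi V = 0 :> 'M_(a, b).
  move=> hy hy' hA /(congr1 (map_mx pi)); rewrite !map_mxB hA subr0 => ->.
  by rewrite !map_mxZ /= hy hy' !scale0r subrr.
by split; [exact: key E1|exact: key E2|exact: key E3].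
Qed.

Lemma in_sq_curl (W1 W2 W3 : 'M_(a, b)) :
  in_sq (x2 *: W3 - x3 *: W2) -> in_sq (x3 *: W1 - x1 *: W3) ->
  [/\ map_mx pi W1 = 0, map_mx pi W2 = 0 & map_mx pi W3 = 0].
Proof.
move=> h1 h2.
have [|_ e3 /eqP e2] := @in_sq_indep 0 W3 (- W2).
  by rewrite scaler0 add0r scalerN.
have [|_ _ e1] := @in_sq_indep (- W3) 0 W1.
  by rewrite scaler0 addr0 addrC scalerN.
by split=> //; apply/eqP; rewrite map_mxN oppr_eq0 in e2.
Qed.

Lemma in_sq_grad (W : 'M_(a, b)) : in_sq (x1 *: W) -> map_mx pi W = 0.
Proof.
move=> h; have [|//] := @in_sq_indep W 0 0.
by rewrite !scaler0 !addr0.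
Qed.

End Independence.

End Koszul.

(** * DG algebra structures on resolutions of length 3 *)

Section Bilinear.
Variables (R : comNzRingType) (p q r : nat).
Implicit Types (t : 'I_p -> 'I_q -> 'rV[R]_r).

(** [dg_mul] is convertible to an instance of this, so that bilinearity is proved once, away from
    the graded indices. *)
Definition bil t (x : 'rV[R]_p) (y : 'rV[R]_q) : 'rV[R]_r :=
  \sum_a \sum_b (x 0 a * y 0 b) *: t a b.

Lemma bilDl t x1 x2 y : bil t (x1 + x2) y = bil t x1 y + bil t x2 y.
Proof.
rewrite -big_split; apply: eq_bigr => a _; rewrite -big_split.
by apply: eq_bigr => b _; rewrite mxE mulrDl scalerDl.
Qed.

Lemma bilDr t x y1 y2 : bil t x (y1 + y2) = bil t x y1 + bil t x y2.
Proof.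
rewrite -big_split; apply: eq_bigr => a _; rewrite -big_split.
by apply: eq_bigr => b _; rewrite mxE mulrDr scalerDl.
Qed.

Lemma bilZl t c x y : bil t (c *: x) y = c *: bil t x y.
Proof.
rewrite scaler_sumr; apply: eq_bigr => a _; rewrite scaler_sumr.
by apply: eq_bigr => b _; rewrite mxE -mulrA scalerA.
Qed.

Lemma bilZr t c x y : bil t x (c *: y) = c *: bil t x y.
Proof.
rewrite scaler_sumr; apply: eq_bigr => a _; rewrite scaler_sumr.
by apply: eq_bigr => b _; rewrite mxE mulrCA scalerA.
Qed.

Lemma bil0l t y : bil t 0 y = 0.
Proof. by rewrite -(scale0r 0) bilZl scale0r. Qed.

Lemma bil0r t x : bil t x 0 = 0.
Proof. by rewrite -(scale0r 0) bilZr scale0r. Qed.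

Lemma bilNr t x y : bil t x (- y) = - bil t x y.
Proof. by rewrite -scaleN1r bilZr scaleN1r. Qed.

Lemma bilBr t x y1 y2 : bil t x (y1 - y2) = bil t x y1 - bil t x y2.
Proof. by rewrite bilDr bilNr. Qed.

Lemma bil_suml t I (s : seq I) (F : I -> 'rV_p) y :
  bil t (\sum_(i <- s) F i) y = \sum_(i <- s) bil t (F i) y.
Proof.
by apply: (big_morph (bil t ^~ y)) => [x1 x2|]; rewrite (bilDl, bil0l).
Qed.

Lemma bil_sumr t I (s : seq I) x (F : I -> 'rV_q) :
  bil t x (\sum_(i <- s) F i) = \sum_(i <- s) bil t x (F i).
Proof. by apply: (big_morph (bil t x)) => [y1 y2|]; rewrite (bilDr, bil0r). Qed.

Lemma bil_mulmxl t n (x : 'rV_n) (A : 'M_(n, p)) y :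
  bil t (x *m A) y = \sum_i x 0 i *: bil t (row i A) y.
Proof.
by rewrite mulmx_sum_row bil_suml; apply: eq_bigr => i _; rewrite bilZl.
Qed.

Lemma bil_mulmxr t n x (y : 'rV_n) (A : 'M_(n, q)) :
  bil t x (y *m A) = \sum_i y 0 i *: bil t x (row i A).
Proof.
by rewrite mulmx_sum_row bil_sumr; apply: eq_bigr => i _; rewrite bilZr.
Qed.

Lemma bil_delta t a b : bil t (delta_mx 0 a) (delta_mx 0 b) = t a b.
Proof.
rewrite /bil (bigD1 a) //= (bigD1 b) //= !mxE !eqxx mulr1 scale1r.
rewrite !big1 ?addr0 // => [a' /negPf na|b' /negPf nb].
  by rewrite big1 // => b' _; rewrite mxE eqxx na mul0r scale0r.
by rewrite !mxE !eqxx nb mulr0 scale0r.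
Qed.

Lemma bil_suml_coef t x y : bil t x y = \sum_a x 0 a *: bil t (delta_mx 0 a) y.
Proof.
rewrite {1}(row_sum_delta x) bil_suml.
by apply: eq_bigr => a _; rewrite bilZl.
Qed.

Lemma bil_sumr_coef t x y : bil t x y = \sum_b y 0 b *: bil t x (delta_mx 0 b).
Proof.
rewrite {1}(row_sum_delta y) bil_sumr.
by apply: eq_bigr => b _; rewrite bilZr.
Qed.

End Bilinear.

Section Length3.
Variable R : comNzRingType.

(* Degrees 0 to 3 of a free resolution with F_0 = R, rows of the matrices being
   the images of the basis vectors, and the tables of the products
   F_1 x F_1 -> F_2 and F_1 x F_2 -> F_3. *)
Record len3 := Len3 {
  l1 : nat; l2 : nat; l3 : nat;
  d1 : 'M[R]_(l1, 1); d2 : 'M[R]_(l2, l1); d3 : 'M[R]_(l3, l2);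
  m11 : 'I_l1 -> 'I_l1 -> 'rV[R]_l2;
  m12 : 'I_l1 -> 'I_l2 -> 'rV[R]_l3
}.

Definition aug (L : len3) (x : 'rV[R]_(l1 L)) : R := (x *m d1 L) 0 0.

Record len3_exact (L : len3) : Prop := Len3Exact {
  d21 : d2 L *m d1 L = 0;
  d32 : d3 L *m d2 L = 0;
  exact1 : forall v : 'rV_(l1 L), v *m d1 L = 0 -> exists w, v = w *m d2 L;
  exact2 : forall v : 'rV_(l2 L), v *m d2 L = 0 -> exists w, v = w *m d3 L;
  inj3 : forall v : 'rV_(l3 L), v *m d3 L = 0 -> v = 0
}.

(** These few identities determine a DG algebra: the missing ones, associativity and the Leibniz
    rule in total degree 4, follow from the injectivity of [d3]. *)
Record len3_algebra (L : len3) : Prop := Len3Algebra {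
  len3_exactW :> len3_exact L;
  m11xx : forall x, bil (@m11 L) x x = 0;
  leib11 : forall x y, bil (@m11 L) x y *m d2 L = aug x *: y - aug y *: x;
  leib12 : forall x c, bil (m12 (l := L)) x c *m d3 L =
    aug x *: c - bil (@m11 L) x (c *m d2 L)
}.

Lemma augD L (x y : 'rV_(l1 L)) : aug (x + y) = aug x + aug y.
Proof. by rewrite /aug mulmxDl mxE. Qed.

Lemma augZ L c (x : 'rV_(l1 L)) : aug (c *: x) = c * aug x.
Proof. by rewrite /aug -scalemxAl mxE. Qed.

Lemma aug_d2 L (c : 'rV_(l2 L)) : len3_exact L -> aug (c *m d2 L) = 0.
Proof. by move=> hL; rewrite /aug -mulmxA d21 // mulmx0 mxE. Qed.

Lemma m11C L (x y : 'rV_(l1 L)) : len3_algebra L ->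
  bil (@m11 L) x y = - bil (@m11 L) y x.
Proof.
move=> hL; apply/eqP; rewrite -addr_eq0; apply/eqP.
have := m11xx hL (x + y).
by rewrite bilDl !bilDr !(m11xx hL) addr0 add0r.
Qed.

Lemma d3_inj L (u v : 'rV_(l3 L)) : len3_exact L ->
  u *m d3 L = v *m d3 L -> u = v.
Proof.
move=> hL h; apply/eqP; rewrite -subr_eq0; apply/eqP/(inj3 hL).
by rewrite mulmxBl h subrr.
Qed.

Definition set_m12 (L : len3) t : len3 :=
  @Len3 (l1 L) (l2 L) (l3 L) (d1 L) (d2 L) (d3 L) (@m11 L) t.

(* Buchsbaum-Eisenbud: a product F_1 x F_1 -> F_2 satisfying the Leibniz rule
   extends to F_1 x F_2 -> F_3 by exactness. *)
Lemma exists_m12 (L : len3) : len3_exact L ->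
    (forall a, @m11 L a a = 0) -> (forall a b, @m11 L a b = - m11 b a) ->
    (forall a b, @m11 L a b *m d2 L =
       d1 L a 0 *: delta_mx 0 b - d1 L b 0 *: delta_mx 0 a) ->
  exists t, len3_algebra (set_m12 (L := L) t).
Proof.
move=> hL halt hanti hleib.
have h11xx x : bil (@m11 L) x x = 0.
  (* 2 may be a zero divisor, so antisymmetry alone does not suffice: the diagonal vanishes by
     [halt], and the terms with [b < a] cancel those with [a < b]. *)
  pose G a b := (x 0 a * x 0 b) *: m11 a b.
  have GC a b : G a b = - G b a by rewrite /G mulrC hanti scalerN.
  rewrite /bil -/G.
  rewrite (eq_bigr (fun a : 'I_(l1 L) => \sum_(b : 'I_(l1 L) | (b < a)%N) G a b +
     \sum_(b : 'I_(l1 L) | (a < b)%N) G a b)); last first.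
    move=> a _; rewrite (bigD1 a) //= -/(G a a) {1}/G halt scaler0 add0r.
    rewrite (bigID (fun b : 'I_(l1 L) => (b < a)%N)) /=.
    congr (_ + _); apply: eq_bigl => b.
      by rewrite andbC -val_eqE /=; case: ltngtP.
    by rewrite -val_eqE /=; case: ltngtP.
  rewrite big_split /= (exchange_big_dep predT) //= -big_split big1 // => b _.
  by rewrite -big_split big1 //= => a _; rewrite GC addNr.
have hleib' x y : bil (@m11 L) x y *m d2 L = aug x *: y - aug y *: x.
  have augE z : aug z = \sum_a z 0 a * d1 L a 0 :> R by rewrite /aug mxE.
  rewrite /bil mulmx_suml.
  under eq_bigr => a _ do rewrite mulmx_suml.
  under eq_bigr => a _ do under eq_bigr => b _ do
    rewrite -scalemxAl hleib scalerBr !scalerA.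
  under eq_bigr => a _ do rewrite sumrB.
  rewrite sumrB; congr (_ - _).
    rewrite {2}(row_sum_delta y) augE scaler_suml; apply: eq_bigr => a _.
    by rewrite scaler_sumr; apply: eq_bigr => b _; rewrite scalerA mulrAC.
  rewrite exchange_big /= {2}(row_sum_delta x) augE scaler_suml.
  apply: eq_bigr => b _; rewrite scaler_sumr; apply: eq_bigr => a _.
  by rewrite scalerA; congr (_ *: _); ring.
have /fin_all_exists[t ht] : forall ac : 'I_(l1 L) * 'I_(l2 L), exists w,
    d1 L ac.1 0 *: delta_mx 0 ac.2
      - bil (@m11 L) (delta_mx 0 ac.1) (row ac.2 (d2 L)) = w *m d3 L.
  move=> [a c] /=; apply: (exact2 hL); rewrite mulmxBl -scalemxAl -rowE hleib'.
  rewrite {1}/aug -rowE mxE (_ : aug (row c (d2 L)) = 0) ?scale0r ?subr0 ?subrr //.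
  by rewrite rowE aug_d2.
exists (fun a c => t (a, c)); split; rewrite /aug //=.
  by case: hL => *; split.
move=> x c; rewrite /bil mulmx_suml.
under eq_bigr => a _ do rewrite mulmx_suml.
under eq_bigr => a _ do under eq_bigr => b _ do
  rewrite -scalemxAl -ht /= scalerBr scalerA.
under eq_bigr => a _ do rewrite sumrB.
rewrite sumrB; congr (_ - _).
  rewrite {2}(row_sum_delta c) mxE scaler_suml; apply: eq_bigr => a _.
  by rewrite scaler_sumr; apply: eq_bigr => b _; rewrite scalerA mulrAC.
rewrite -/(bil _ _ _) bil_suml_coef; apply: eq_bigr => a _.
rewrite bil_mulmxr scaler_sumr; apply: eq_bigr => b _.
by rewrite scalerA.
Qed.

(** * The DG algebra carried by length 3 data *)

Section DG.
Variable L : len3.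

Definition rk3 i := match i with
  0 => 1%N | 1 => l1 L | 2 => l2 L | 3 => l3 L | _ => 0%N end.

Definition dif3 i : 'M[R]_(rk3 i, rk3 i.-1) :=
  match i return 'M[R]_(rk3 i, rk3 i.-1) with
  | 0 => 0 | 1 => d1 L | 2 => d2 L | 3 => d3 L | _ => 0 end.

(** Degree 0 acts by scalars. The product of degrees 2 and 1 is the one of degrees 1 and 2 with the
    factors swapped, without sign because 1 * 2 is even. *)
Definition tbl3 i j l : 'I_(rk3 i) -> 'I_(rk3 j) -> 'rV[R]_(rk3 l) :=
  match i, j, l return 'I_(rk3 i) -> 'I_(rk3 j) -> 'rV[R]_(rk3 l) with
  | 0, 0, 0 => fun _ b => delta_mx 0 b
  | 0, 1, 1 => fun _ b => delta_mx 0 b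
  | 0, 2, 2 => fun _ b => delta_mx 0 b
  | 0, 3, 3 => fun _ b => delta_mx 0 b
  | 1, 0, 1 => fun a _ => delta_mx 0 a
  | 2, 0, 2 => fun a _ => delta_mx 0 a
  | 3, 0, 3 => fun a _ => delta_mx 0 a
  | 1, 1, 2 => fun a b => m11 a b
  | 1, 2, 3 => fun a b => m12 a b
  | 2, 1, 3 => fun a b => m12 b a
  | _, _, _ => fun _ _ => 0
  end.

Definition dg3 : dg_data R :=
  @DGData R (@FreeComplex R rk3 dif3) tbl3 (const_mx 1 : 'rV_1).

Hypothesis hL : len3_algebra L.

(** Disposes of all cases involving a degree above 3, where the modules have rank 0. *)
Lemma thin_eq n (A B : 'M[R]_(n, 0)) : A = B.
Proof. by rewrite [A]thinmx0 [B]thinmx0. Qed.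

Lemma bil_unitl n (x : 'rV[R]_1) (y : 'rV_n) :
  bil (fun _ b => delta_mx 0 b) x y = x 0 0 *: y.
Proof.
rewrite /bil big_ord1 {2}(row_sum_delta y) scaler_sumr.
by apply: eq_bigr => b _; rewrite scalerA.
Qed.

Lemma bil_unitr n (x : 'rV_n) (y : 'rV[R]_1) :
  bil (fun a _ => delta_mx 0 a) x y = y 0 0 *: x.
Proof.
rewrite /bil {2}(row_sum_delta x) scaler_sumr; apply: eq_bigr => a _.
by rewrite big_ord1 mulrC scalerA.
Qed.

Lemma dg_mul0l j (x : 'rV[R]_1) (y : 'rV_(rk3 j)) :
  @dg_mul R dg3 0 j j x y = x 0 0 *: y.
Proof.
by case: j y => [|[|[|[|j]]]] y; try exact: bil_unitl; exact: thin_eq.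
Qed.

Lemma dg_mul0r i (x : 'rV_(rk3 i)) (y : 'rV[R]_1) :
  @dg_mul R dg3 i 0 i x y = y 0 0 *: x.
Proof.
case: i x => [|[|[|[|i]]]] x; try exact: bil_unitr; last exact: thin_eq.
rewrite [LHS]bil_unitl; apply/rowP => i.
by rewrite !mxE ord1 mulrC.
Qed.

Lemma dg_mul11 x y : @dg_mul R dg3 1 1 2 x y = bil (@m11 L) x y.
Proof. by []. Qed.

Lemma dg_mul12 x y : @dg_mul R dg3 1 2 3 x y = bil (@m12 L) x y.
Proof. by []. Qed.

Lemma dg_mul21 x y : @dg_mul R dg3 2 1 3 x y = bil (@m12 L) y x.
Proof.
rewrite /dg_mul /bil exchange_big; apply: eq_bigr => a _; apply: eq_bigr => b _.
by rewrite mulrC.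
Qed.

(** The Leibniz rule in degrees 1 and 3, whose product lies in [F_4 = 0]. As in the next two lemmas,
    both sides are compared after applying the injective [d3]. *)
Lemma m12_d3 x y : bil (@m12 L) x (y *m d3 L) = aug x *: y.
Proof.
apply: (d3_inj hL).
by rewrite leib12 // -mulmxA (d32 hL) mulmx0 bil0r subr0 scalemxAl.
Qed.

(** The Leibniz rule in degrees 2 and 2, again with a product in [F_4 = 0]. *)
Lemma m12_d2 x y :
  bil (@m12 L) (x *m d2 L) y = - bil (@m12 L) (y *m d2 L) x.
Proof.
apply: (d3_inj hL); rewrite mulNmx !leib12 // !(aug_d2 _ hL) !scale0r !sub0r opprK.
by rewrite m11C // opprK.
Qed.

(** Associativity for three elements of degree 1, the left-hand side being the product of [m11 x y]
    with [z] after commutation. *)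
Lemma m12_m11 x y z :
  bil (@m12 L) z (bil (@m11 L) x y) = bil (@m12 L) x (bil (@m11 L) y z).
Proof.
apply: (d3_inj hL); rewrite !leib12 // !leib11 // !bilBr !bilZr.
rewrite (m11C z y) // (m11C z x) // (m11C x z) //.
by apply/rowP => i; rewrite !mxE; ring.
Qed.

Lemma dg3_graded i j l (x : 'rV_(rk3 i)) (y : 'rV_(rk3 j)) :
  l <> (i + j)%N -> @dg_mul R dg3 i j l x y = 0.
Proof.
move=> h; rewrite /dg_mul big1 // => a _; rewrite big1 // => b _.
suff -> : @tbl R dg3 i j l a b = 0 by rewrite scaler0.
move: i j l {x y} h a b.
by move=> [|[|[|[|i]]]] [|[|[|[|j]]]] [|[|[|[|l]]]] //= h; case: h.
Qed.

Lemma dg3_mulA i j l (x : 'rV_(rk3 i)) (y : 'rV_(rk3 j)) (z : 'rV_(rk3 l)) :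
    dg_mul dg3 (i + j + l) (dg_mul dg3 (i + j) x y) z =
    dg_mul dg3 (i + j + l) x (dg_mul dg3 (j + l) y z).
Proof.
case: i x => [|i] x.
  (* Once the degrees are literals, their sums compute; the [change] steps restate the goal with the
     reduced indices, which removes the dependent types from the way. *)
  change (dg_mul dg3 (j + l) (dg_mul dg3 j x y) z =
          dg_mul dg3 (j + l) x (dg_mul dg3 (j + l) y z)).
  by rewrite !dg_mul0l; apply: bilZl.
have hZ n (c : R) (w : 'rV_(rk3 i.+1)) :
    dg_mul dg3 n (c *: w) z = c *: dg_mul dg3 n w z by apply: bilZl.
have hZr n (c : R) (w : 'rV_(rk3 l)) :
    dg_mul dg3 n x (c *: w) = c *: dg_mul dg3 n x w by apply: bilZr.
case: j y => [|j] y.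
  case: i x hZ hZr => [|[|[|i]]] x hZ hZr; last exact: thin_eq.
  - change (dg_mul dg3 (1 + l) (dg_mul dg3 1 x y) z =
            dg_mul dg3 (1 + l) x (dg_mul dg3 l y z)).
    by rewrite (@dg_mul0r 1) dg_mul0l hZ hZr.
  - change (dg_mul dg3 (2 + l) (dg_mul dg3 2 x y) z =
            dg_mul dg3 (2 + l) x (dg_mul dg3 l y z)).
    by rewrite (@dg_mul0r 2) dg_mul0l hZ hZr.
  - change (dg_mul dg3 (3 + l) (dg_mul dg3 3 x y) z =
            dg_mul dg3 (3 + l) x (dg_mul dg3 l y z)).
    by rewrite (@dg_mul0r 3) dg_mul0l hZ hZr.
case: i x {hZ hZr} => [|[|[|i]]] x; [| |exact: thin_eq..];
  (case: j y => [|[|j]] y); (case: l z => [|[|l]] z); try exact: thin_eq.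
- change (dg_mul dg3 2 (dg_mul dg3 2 x y) z = dg_mul dg3 2 x (dg_mul dg3 1 y z)).
  rewrite (@dg_mul0r 2) (@dg_mul0r 1); symmetry; apply: bilZr.
- change (dg_mul dg3 3 (dg_mul dg3 2 x y) z = dg_mul dg3 3 x (dg_mul dg3 2 y z)).
  by rewrite dg_mul21 dg_mul12 m12_m11.
- change (dg_mul dg3 3 (dg_mul dg3 3 x y) z = dg_mul dg3 3 x (dg_mul dg3 2 y z)).
  rewrite (@dg_mul0r 3) (@dg_mul0r 2); symmetry; apply: bilZr.
- change (dg_mul dg3 3 (dg_mul dg3 3 x y) z = dg_mul dg3 3 x (dg_mul dg3 1 y z)).
  rewrite (@dg_mul0r 3) (@dg_mul0r 1); symmetry; apply: bilZr.
Qed.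

Lemma dg3_mulC i j (x : 'rV_(rk3 i)) (y : 'rV_(rk3 j)) :
  dg_mul dg3 (i + j) x y = (-1) ^+ (i * j) *: dg_mul dg3 (i + j) y x.
Proof.
have m1 : (-1) ^+ 2 = 1 :> R by rewrite sqrrN expr1n.
case: i x => [|i] x.
  change (dg_mul dg3 j x y = 1 *: dg_mul dg3 j y x).
  by rewrite dg_mul0l dg_mul0r scale1r.
case: j y => [|j] y.
  case: i x => [|[|[|i]]] x; last exact: thin_eq.
  - change (dg_mul dg3 1 x y = 1 *: dg_mul dg3 1 y x).
    by rewrite (@dg_mul0r 1) dg_mul0l scale1r.
  - change (dg_mul dg3 2 x y = 1 *: dg_mul dg3 2 y x).
    by rewrite (@dg_mul0r 2) dg_mul0l scale1r.
  - change (dg_mul dg3 3 x y = 1 *: dg_mul dg3 3 y x).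
    by rewrite (@dg_mul0r 3) dg_mul0l scale1r.
case: i x => [|[|[|i]]] x; [| |exact: thin_eq..];
  (case: j y => [|[|j]] y); try exact: thin_eq.
- change (dg_mul dg3 2 x y = -1 *: dg_mul dg3 2 y x).
  by rewrite !dg_mul11 scaleN1r m11C.
- change (dg_mul dg3 3 x y = (-1) ^+ 2 *: dg_mul dg3 3 y x).
  by rewrite dg_mul21 dg_mul12 m1 scale1r.
- change (dg_mul dg3 3 x y = (-1) ^+ 2 *: dg_mul dg3 3 y x).
  by rewrite dg_mul21 dg_mul12 m1 scale1r.
Qed.

Lemma dg3_leibniz i j (x : 'rV_(rk3 i)) (y : 'rV_(rk3 j)) :
  dg_mul dg3 (i + j) x y *m dif dg3 (i + j) =
  dg_mul dg3 (i + j).-1 (x *m dif dg3 i) y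
    + (-1) ^+ i *: dg_mul dg3 (i + j).-1 x (y *m dif dg3 j).
Proof.
have z0l a b c (w : 'rV_(rk3 b)) : @dg_mul R dg3 a b c 0 w = 0 by apply: bil0l.
have z0r a b c (w : 'rV_(rk3 a)) : @dg_mul R dg3 a b c w 0 = 0 by apply: bil0r.
have m1 : (-1) ^+ 2 = 1 :> R by rewrite sqrrN expr1n.
case: i x => [|[|[|[|i]]]] x; last first.
- by rewrite (thin_eq x 0) mul0mx !z0l mul0mx scaler0 addr0.
- case: j y => [|[|j]] y; last exact: thin_eq.
    change (dg_mul dg3 3 x y *m d3 L =
      @dg_mul R dg3 2 0 2 (x *m d3 L) y
        + (-1) ^+ 3 *: @dg_mul R dg3 3 0 2 x (y *m (0 : 'M_1))).
    by rewrite mulmx0 z0r scaler0 addr0 (@dg_mul0r 3) (@dg_mul0r 2) scalemxAl.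
  (* In total degree 4 the left-hand side is 0, and the Leibniz rule says that the two terms on the
     right cancel. *)
  change (dg_mul dg3 4 x y *m (0 : 'M_(0, l3 L)) =
    @dg_mul R dg3 2 1 3 (x *m d3 L) y
        + (-1) ^+ 3 *: @dg_mul R dg3 3 0 3 x (y *m d1 L)).
  rewrite mulmx0 (@dg_mul0r 3) dg_mul21 m12_d3 -/(aug y).
  by rewrite exprS m1 mulr1 scaleN1r subrr.
- case: j y => [|[|[|j]]] y; last exact: thin_eq.
  + change (dg_mul dg3 2 x y *m d2 L =
      @dg_mul R dg3 1 0 1 (x *m d2 L) y
        + (-1) ^+ 2 *: @dg_mul R dg3 2 0 1 x (y *m (0 : 'M_1))).
    by rewrite mulmx0 z0r scaler0 addr0 (@dg_mul0r 2) (@dg_mul0r 1) scalemxAl.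
  + change (dg_mul dg3 3 x y *m d3 L =
      @dg_mul R dg3 1 1 2 (x *m d2 L) y
        + (-1) ^+ 2 *: @dg_mul R dg3 2 0 2 x (y *m d1 L)).
    rewrite (@dg_mul0r 2) dg_mul21 leib12 // dg_mul11 m1 scale1r (m11C y) //.
    by rewrite opprK addrC.
  + change (dg_mul dg3 4 x y *m (0 : 'M_(0, l3 L)) =
      @dg_mul R dg3 1 2 3 (x *m d2 L) y
        + (-1) ^+ 2 *: @dg_mul R dg3 2 1 3 x (y *m d2 L)).
    by rewrite mulmx0 dg_mul12 dg_mul21 m1 scale1r m12_d2 addNr.
- case: j y => [|[|[|[|j]]]] y; last exact: thin_eq.
  + change (dg_mul dg3 1 x y *m d1 L =
      @dg_mul R dg3 0 0 0 (x *m d1 L) y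
        + (-1) ^+ 1 *: @dg_mul R dg3 1 0 0 x (y *m (0 : 'M_1))).
    by rewrite mulmx0 z0r scaler0 addr0 (@dg_mul0r 1) (@dg_mul0r 0) scalemxAl.
  + change (dg_mul dg3 2 x y *m d2 L =
      @dg_mul R dg3 0 1 1 (x *m d1 L) y
        + (-1) ^+ 1 *: @dg_mul R dg3 1 0 1 x (y *m d1 L)).
    by rewrite dg_mul0l (@dg_mul0r 1) dg_mul11 leib11 // expr1 scaleN1r.
  + change (dg_mul dg3 3 x y *m d3 L =
      @dg_mul R dg3 0 2 2 (x *m d1 L) y
        + (-1) ^+ 1 *: @dg_mul R dg3 1 1 2 x (y *m d2 L)).
    by rewrite dg_mul0l dg_mul11 dg_mul12 leib12 // expr1 scaleN1r.
  + change (dg_mul dg3 4 x y *m (0 : 'M_(0, l3 L)) =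
      @dg_mul R dg3 0 3 3 (x *m d1 L) y
        + (-1) ^+ 1 *: @dg_mul R dg3 1 2 3 x (y *m d3 L)).
    by rewrite mulmx0 dg_mul0l dg_mul12 m12_d3 expr1 scaleN1r subrr.
- case: j y => [|j] y.
    change (dg_mul dg3 0 x y *m (0 : 'M_1) =
      @dg_mul R dg3 0 0 0 (x *m (0 : 'M_1)) y
        + 1 *: @dg_mul R dg3 0 0 0 x (y *m (0 : 'M_1))).
    by rewrite !mulmx0 z0l z0r scaler0 addr0.
  change (dg_mul dg3 j.+1 x y *m dif dg3 j.+1 =
    @dg_mul R dg3 0 j.+1 j (x *m (0 : 'M_1)) y
        + 1 *: @dg_mul R dg3 0 j j x (y *m dif dg3 j.+1)).
  by rewrite !mulmx0 z0l add0r scale1r dg_mul0l (@dg_mul0l j) scalemxAl.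
Qed.

Lemma dg3_difK i : dif dg3 i.+1 *m dif dg3 i = 0.
Proof.
case: i => [|[|[|i]]]; [exact: mulmx0|exact: (d21 hL)|exact: (d32 hL)|].
exact: mul0mx.
Qed.

Lemma dg3_algebra : is_dg_algebra dg3.
Proof.
split=> //; [exact: dg3_difK|exact: dg3_graded| |exact: dg3_mulA|
  exact: dg3_mulC| |exact: dg3_leibniz].
- by move=> i x; rewrite dg_mul0l /= mxE scale1r.
- by move=> [|[|[|[|i]]]] x //= _; [exact: (m11xx hL)|exact: thin_eq..].
Qed.

Lemma dg3_resolution (J : set R) :
  (forall r, J r <-> exists y : 'rV_(l1 L), aug y = r) -> dg_resolution dg3 J.
Proof.
move=> hJ; split; first exact: dg3_algebra.
have e1 (r : R) (v : 'rV[R]_1) : v = r *: const_mx 1 <-> v 0 0 = r.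
  split=> [->|<-]; first by rewrite !mxE mulr1.
  by apply/rowP => i; rewrite !mxE mulr1 ord1.
split=> //.
- exact: dg3_difK.
- move=> v; exists (v 0 0); split; first exact/e1.
  by move=> r /e1.
- move=> r; split=> [/hJ[y hy]|[y /e1 hy]]; first by exists y; apply/e1.
  by apply/hJ; exists y.
- move=> [|[|[|i]]] v hv; [exact: (exact1 hL)|exact: (exact2 hL)| |].
  + by exists 0; rewrite mul0mx; apply: (inj3 hL).
  + by exists 0; exact: thin_eq.
Qed.

End DG.
End Length3.

Lemma map_bil (R S : comNzRingType) (f : {rmorphism R -> S}) p q r
    (t : 'I_p -> 'I_q -> 'rV[R]_r) x y :
  map_mx f (bil t x y) = bil (fun a b => map_mx f (t a b)) (map_mx f x) (map_mx f y).
Proof.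
rewrite raddf_sum; apply: eq_bigr => a _; rewrite raddf_sum; apply: eq_bigr => b _.
by rewrite /= map_mxZ !mxE rmorphM.
Qed.

(** * The trimming complex *)

Section Trimming.
Variables (R : comNzRingType) (k : fieldType) (pi : {rmorphism R -> k}).
Variables (x1 x2 x3 : R).
Hypothesis pi_ker : forall r,
  pi r = 0 <-> exists c1 c2 c3, r = x1 * c1 + x2 * c2 + x3 * c3.
Hypothesis exK : forall a b, koszul_exact x1 x2 x3 a b.
Variables (L : len3 R).
Hypothesis hL : len3_algebra L.
Local Notation in_sq := (in_sq x1 x2 x3 pi).

(* The rows of A and B form a basis of F_1; the generators to be trimmed are
   those of B. *)
Variables (s t : nat) (A : 'M[R]_(s, l1 L)) (B : 'M[R]_(t, l1 L)).
Variables (A' : 'M[R]_(l1 L, s)) (B' : 'M[R]_(l1 L, t)).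
Hypotheses (AA' : A *m A' = 1%:M) (BB' : B *m B' = 1%:M).
Hypotheses (AB' : A *m B' = 0) (BA' : B *m A' = 0).
Hypothesis A'AB'B : A' *m A + B' *m B = 1%:M.
Hypotheses (sq2 : in_sq (d2 L)) (min3 : map_mx pi (d3 L) = 0).

(** The map [T_1 -> F_1]: first the kept generators, then [K_1] tensored with the trimmed ones, one
    block for each [x_i]. *)
Definition trim_gens : 'M[R]_(s + (t + (t + t)), l1 L) :=
  col_mx A (col_mx (x1 *: B) (col_mx (x2 *: B) (x3 *: B))).

Hypothesis sq1 : in_sq (trim_gens *m d1 L).

(** The Koszul differential [K_2 -> K_1] with [t] copies, extended by 0 to the kept generators; on
    row vectors it is the cross product with x. *)
Definition curl_mx : 'M[R]_(t + (t + t), s + (t + (t + t))) :=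
  row_mx 0 (col_mx (row_mx 0 (row_mx x3%:M (- x2)%:M))
    (col_mx (row_mx (- x3)%:M (row_mx 0 x1%:M))
            (row_mx x2%:M (row_mx (- x1)%:M 0)))).

Definition grad_mx : 'M[R]_(t, t + (t + t)) :=
  row_mx x1%:M (row_mx x2%:M x3%:M).

Lemma mul_curl_mx r (W1 W2 W3 : 'M[R]_(r, t)) :
  row_mx W1 (row_mx W2 W3) *m curl_mx =
  row_mx 0 (row_mx (x2 *: W3 - x3 *: W2)
    (row_mx (x3 *: W1 - x1 *: W3) (x1 *: W2 - x2 *: W1))).
Proof.
rewrite mul_mx_row mulmx0 !mul_row_col !mul_mx_row !mulmx0 !mul_mx_scalar.
rewrite !add_row_mx !add0r !addr0 !scaleNr.
by rewrite (addrC (- _) (x2 *: W3)) (addrC (- _) (x1 *: W2)).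
Qed.

Lemma mul_grad_mx r (W : 'M[R]_(r, t)) :
  W *m grad_mx = row_mx (x1 *: W) (row_mx (x2 *: W) (x3 *: W)).
Proof. by rewrite !mul_mx_row !mul_mx_scalar. Qed.

Lemma mul_trim_gens r (V0 : 'M[R]_(r, s)) (V1 V2 V3 : 'M[R]_(r, t)) :
  row_mx V0 (row_mx V1 (row_mx V2 V3)) *m trim_gens =
  V0 *m A + (x1 *: V1 + x2 *: V2 + x3 *: V3) *m B.
Proof.
by rewrite !mul_row_col -!scalemxAr !mulmxDl -!scalemxAl !addrA.
Qed.

Lemma row4P r (V : 'M[R]_(r, s + (t + (t + t)))) :
  exists V0 V1 V2 V3, V = row_mx V0 (row_mx V1 (row_mx V2 V3)).
Proof.
exists (lsubmx V), (lsubmx (rsubmx V)), (lsubmx (rsubmx (rsubmx V))),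
  (rsubmx (rsubmx (rsubmx V))).
by rewrite !hsubmxK.
Qed.

Lemma row3P r (V : 'M[R]_(r, t + (t + t))) :
  exists V1 V2 V3, V = row_mx V1 (row_mx V2 V3).
Proof.
exists (lsubmx V), (lsubmx (rsubmx V)), (rsubmx (rsubmx V)).
by rewrite !hsubmxK.
Qed.

Lemma curl_gens0 : curl_mx *m trim_gens = 0.
Proof.
rewrite -[curl_mx]mul1mx; have [W1 [W2 [W3 ->]]] := row3P 1%:M.
rewrite mul_curl_mx mul_trim_gens mul0mx add0r.
set X := (X in X *m B); suff -> : X = 0 by rewrite mul0mx.
by apply/matrixP => i j; rewrite !mxE; ring.
Qed.

Lemma grad_curl0 : grad_mx *m curl_mx = 0.
Proof.
rewrite -[grad_mx]mul1mx mul_grad_mx mul_curl_mx.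
by rewrite !scalerA ![_ * x1]mulrC (mulrC x3 x2) !subrr !row_mx0.
Qed.

Lemma gens_exact r (V : 'M[R]_(r, s + (t + (t + t)))) :
  V *m trim_gens = 0 -> exists W, V = W *m curl_mx.
Proof.
have [V0 [V1 [V2 [V3 ->]]]] := row4P V; rewrite mul_trim_gens => h.
have V00 : V0 = 0.
  move/(congr1 (mulmx^~ A')): h; rewrite mulmxDl -!mulmxA AA' BA'.
  by rewrite mulmx0 mulmx1 mul0mx addr0.
have hV : x1 *: V1 + x2 *: V2 + x3 *: V3 = 0.
  move/(congr1 (mulmx^~ B')): h; rewrite mulmxDl -!mulmxA AB' BB'.
  by rewrite mulmx0 mulmx1 mul0mx add0r.
have [_ _ hcurl] := exK r t; have [W1 [W2 [W3 [-> -> ->]]]] := hcurl _ _ _ hV.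
by exists (row_mx W1 (row_mx W2 W3)); rewrite mul_curl_mx V00.
Qed.

Lemma curl_exact r (V : 'M[R]_(r, t + (t + t))) :
  V *m curl_mx = 0 -> exists W, V = W *m grad_mx.
Proof.
have [V1 [V2 [V3 ->]]] := row3P V; rewrite mul_curl_mx => h.
have [_ hgrad _] := exK r t.
have [W [-> -> ->]] : exists W,
    [/\ V1 = x1 *: W, V2 = x2 *: W & V3 = x3 *: W].
  move: h; rewrite -!row_mx0 => /eq_row_mx[_ /eq_row_mx[/eqP h1]].
  move=> /eq_row_mx[/eqP h2 /eqP h3].
  by apply: hgrad; apply/eqP; rewrite -subr_eq0.
by exists W; rewrite mul_grad_mx.
Qed.

Lemma grad_inj r (W : 'M[R]_(r, t)) : W *m grad_mx = 0 -> W = 0.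
Proof.
rewrite mul_grad_mx -!row_mx0 => /eq_row_mx[h1 /eq_row_mx[h2 h3]].
by have [hinj _ _] := exK r t; apply: hinj.
Qed.

Lemma in_sq_lsubmx a b c (V : 'M[R]_(a, b + c)) : in_sq V -> in_sq (lsubmx V).
Proof.
move=> [V1 [V2 [V3 [-> h1 h2 h3]]]].
exists (lsubmx V1), (lsubmx V2), (lsubmx V3).
by rewrite !map_lsubmx h1 h2 h3 !linear0 !linearD !linearZ.
Qed.

Lemma in_sq_rsubmx a b c (V : 'M[R]_(a, b + c)) : in_sq V -> in_sq (rsubmx V).
Proof.
move=> [V1 [V2 [V3 [-> h1 h2 h3]]]].
exists (rsubmx V1), (rsubmx V2), (rsubmx V3).
by rewrite !map_rsubmx h1 h2 h3 !linear0 !linearD !linearZ.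
Qed.

Lemma in_sq_curl_mx r (W : 'M[R]_(r, t + (t + t))) :
  in_sq (W *m curl_mx) -> map_mx pi W = 0.
Proof.
have [W1 [W2 [W3 ->]]] := row3P W; rewrite mul_curl_mx.
move=> /in_sq_rsubmx; rewrite row_mxKr => h.
have := in_sq_lsubmx h; rewrite row_mxKl => h1.
have := in_sq_lsubmx (in_sq_rsubmx h); rewrite row_mxKr row_mxKl => h2.
have [e1 e2 e3] := in_sq_curl pi_ker (exK r t) h1 h2.
by rewrite !map_row_mx e1 e2 e3 !row_mx0.
Qed.

Lemma in_sq_grad_mx r (W : 'M[R]_(r, t)) :
  in_sq (W *m grad_mx) -> map_mx pi W = 0.
Proof.
rewrite mul_grad_mx => /in_sq_lsubmx; rewrite row_mxKl.
exact: (in_sq_grad pi_ker (exK r t)).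
Qed.

Lemma pi_curl_mx : map_mx pi curl_mx = 0.
Proof.
have [e1 e2 e3] := pi_x pi_ker.
rewrite -[curl_mx]mul1mx; have [W1 [W2 [W3 ->]]] := row3P 1%:M.
rewrite mul_curl_mx !map_row_mx map_mx0 !map_mxB !map_mxZ /= e1 e2 e3.
by rewrite !scale0r !subrr !row_mx0.
Qed.

Lemma pi_grad_mx : map_mx pi grad_mx = 0.
Proof.
have [e1 e2 e3] := pi_x pi_ker.
rewrite -[grad_mx]mul1mx mul_grad_mx !map_row_mx !map_mxZ /= e1 e2 e3.
by rewrite !scale0r !row_mx0.
Qed.

Lemma pi_gen_rshift i : map_mx pi (row (rshift s i) trim_gens) = 0.
Proof.
have [e1 e2 e3] := pi_x pi_ker.
rewrite rowKd map_row !map_col_mx !map_mxZ /= e1 e2 e3 !scale0r !col_mx0.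
exact: row0.
Qed.

(** The component of [d2] along B lies in m^2, so it is a sum of [x_i b_i] with [b_i] in m, and the
    [b_i] are the Koszul part of the lift. The component along A stays in m^2, which later controls
    the products of degrees 1 and 2. *)
Lemma lift_d2 : exists Q : 'M[R]_(l2 L, s + (t + (t + t))),
  [/\ Q *m trim_gens = d2 L, map_mx pi Q = 0 & in_sq (lsubmx Q)].
Proof.
have [b1 [b2 [b3 [hb h1 h2 h3]]]] := in_sqMr B' sq2.
have sqa := in_sqMr A' sq2.
exists (row_mx (d2 L *m A') (row_mx b1 (row_mx b2 b3))); split.
- by rewrite mul_trim_gens -hb -!mulmxA -mulmxDr A'AB'B mulmx1.
- by rewrite !map_row_mx h1 h2 h3 (in_sq_pi pi_ker sqa) !row_mx0.
- by rewrite row_mxKl.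
Qed.

(** [d3 L *m Q] dies in [F_1], hence is a curl; being a product of two matrices over m, it lies in
    m^2, and curl reflects this. *)
Lemma lift_d3 (Q : 'M[R]_(l2 L, s + (t + (t + t)))) :
    Q *m trim_gens = d2 L -> map_mx pi Q = 0 ->
  exists2 Q3, d3 L *m Q = Q3 *m curl_mx & map_mx pi Q3 = 0.
Proof.
move=> hQ mQ; have [Q3 hQ3] : exists Q3, d3 L *m Q = Q3 *m curl_mx.
  by apply: gens_exact; rewrite -mulmxA hQ (d32 hL).
by exists Q3 => //; apply: in_sq_curl_mx; rewrite -hQ3; apply: in_sqM.
Qed.

(** The lift [Q] of [d2] does not compose to 0 with [d3]; the block [- Q3] compensates the Koszul
    boundary that arises. *)
Definition trim_len3 Q (Q3 : 'M[R]_(l3 L, t + (t + t))) M11 M12 : len3 R :=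
  @Len3 R (s + (t + (t + t))) (l2 L + (t + (t + t))) (l3 L + t)
    (trim_gens *m d1 L) (col_mx Q curl_mx) (block_mx (d3 L) (- Q3) 0 grad_mx)
    M11 M12.

(** In each degree a cycle is first treated in F; what remains lies in the Koszul part, where
    exactness of K applies. *)
Lemma trim_exact Q Q3 M11 M12 :
    Q *m trim_gens = d2 L -> d3 L *m Q = Q3 *m curl_mx ->
  len3_exact (trim_len3 Q Q3 M11 M12).
Proof.
move=> hQ hQ3; split=> /=.
- by rewrite mulmxA mul_col_mx hQ curl_gens0 mul_col_mx (d21 hL) mul0mx col_mx0.
- rewrite mul_block_col mul0mx add0r grad_curl0 mulNmx hQ3 subrr.
  by rewrite col_mx0.
- move=> v; rewrite mulmxA => /(exact1 hL)[w hw].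
  have [g hg] : exists g, v - w *m Q = g *m curl_mx.
    by apply: gens_exact; rewrite mulmxBl -mulmxA hQ hw subrr.
  by exists (row_mx w g); rewrite mul_row_col -hg addrC subrK.
- move=> v; rewrite -[v]hsubmxK mul_row_col; set w := lsubmx v; set g := rsubmx v.
  move=> h; have /(exact2 hL)[u hu] : w *m d2 L = 0.
    move/(congr1 (mulmx^~ trim_gens)): h.
    by rewrite mulmxDl -!mulmxA hQ curl_gens0 mulmx0 addr0 mul0mx.
  have [h' hh'] : exists h', g + u *m Q3 = h' *m grad_mx.
    by apply: curl_exact; rewrite mulmxDl -mulmxA -hQ3 mulmxA -hu addrC.
  exists (row_mx u h'); rewrite mul_row_block mulmx0 addr0 -hu -hh'.
  by rewrite mulmxN addrC addrK.
- move=> v; rewrite -[v]hsubmxK mul_row_block -row_mx0 mulmx0 addr0.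
  move=> /eq_row_mx[/(inj3 hL)->]; rewrite mul0mx add0r => /grad_inj->.
  by rewrite row_mx0.
Qed.

Local Notation "x ** y" := (bil (@m11 R L) x y) (at level 40).
Local Notation gen a := (row a trim_gens).

(** The Leibniz rule prescribes the differential of a product. After subtracting the contribution of
    the product in F, what is left is killed by [trim_gens], hence is the curl of a Koszul
    component. *)
Lemma trim_m11 (Q : 'M[R]_(l2 L, s + (t + (t + t)))) :
  Q *m trim_gens = d2 L -> exists M : 'I_(s + (t + (t + t))) -> _ -> 'rV_(_ + _),
  [/\ forall a, M a a = 0, forall a b, M a b = - M b a,
      forall a b, lsubmx (M a b) = gen a ** gen b
    & forall a b, M a b *m col_mx Q curl_mx =
        (trim_gens *m d1 L) a 0 *: delta_mx 0 b
        - (trim_gens *m d1 L) b 0 *: delta_mx 0 a].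
Proof.
move=> hQ.
have hgen a : (trim_gens *m d1 L) a 0 = aug (gen a).
  by rewrite /aug -row_mul [RHS]mxE.
have /fin_all_exists[K hK] : forall ab : 'I_(s + (t + (t + t))) * 'I_(s + (t + (t + t))),
    exists w, (trim_gens *m d1 L) ab.1 0 *: delta_mx 0 ab.2
        - (trim_gens *m d1 L) ab.2 0 *: delta_mx 0 ab.1
        - (gen ab.1 ** gen ab.2) *m Q = w *m curl_mx.
  move=> [a b] /=; apply: gens_exact.
  by rewrite !mulmxBl -!scalemxAl -!rowE -mulmxA hQ leib11 // !hgen subrr.
pose N a b := row_mx (gen a ** gen b) (K (a, b)).
(* Arbitrary lifts need not be antisymmetric, so only those with [a < b] are kept and the others are
   defined by antisymmetry. *)
exists (fun a b : 'I_(s + (t + (t + t))) =>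
  if (a < b)%N then N a b else if (b < a)%N then - N b a else 0).
split=> [a|a b|a b|a b].
- by rewrite ltnn.
- by case: ltngtP => _; rewrite ?opprK ?oppr0.
- case: ltngtP => [_|_|/val_inj->]; rewrite ?row_mxKl //.
    by rewrite linearN /= row_mxKl -m11C.
  by rewrite linear0 (m11xx hL).
- have hN c d : N c d *m col_mx Q curl_mx =
        (trim_gens *m d1 L) c 0 *: delta_mx 0 d
        - (trim_gens *m d1 L) d 0 *: delta_mx 0 c.
    by rewrite mul_row_col -hK /= addrC subrK.
  case: ltngtP => [_|_|/val_inj->]; rewrite ?hN //.
    by rewrite mulNmx hN opprB.
  by rewrite mul0mx subrr.
Qed.

Lemma trimming_algebra : exists Q Q3 M11 M12,
  let T := trim_len3 Q Q3 M11 M12 in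
  [/\ len3_algebra T, map_mx pi (d2 T) = 0, map_mx pi (d3 T) = 0,
      forall a b, exists2 w, M11 a b = row_mx (gen a ** gen b) w &
        (map_mx pi (gen a ** gen b) = 0 -> map_mx pi w = 0)
    & forall a c, exists2 w, bil M12 (delta_mx 0 a) c =
          row_mx (bil (@m12 R L) (gen a) (lsubmx c)) w &
        (map_mx pi (bil (@m12 R L) (gen a) (lsubmx c)) = 0 -> map_mx pi w = 0)].
Proof.
have [Q [hQ mQ sqQ]] := lift_d2; have [Q3 hQ3 mQ3] := lift_d3 hQ mQ.
have [M [Maa Mab lM dM]] := trim_m11 hQ.
(* The zero table is a placeholder that [exists_m12] replaces. *)
have [M12 hM12] := @exists_m12 R (trim_len3 Q Q3 M (fun _ _ => 0))
  (trim_exact _ _ hQ hQ3) Maa Mab dM.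
exists Q, Q3, M, M12; set T := trim_len3 Q Q3 M M12.
have hT : len3_algebra T := hM12.
have mT2 : map_mx pi (d2 T) = 0 by rewrite map_col_mx mQ pi_curl_mx col_mx0.
have mT3 : map_mx pi (d3 T) = 0.
  rewrite map_block_mx map_mxN mQ3 min3 map_mx0 pi_grad_mx oppr0.
  by rewrite block_mxEv !row_mx0 col_mx0.
have sq_aug a n (v : 'rV_n) : in_sq ((trim_gens *m d1 L) a 0 *: v).
  suff -> : (trim_gens *m d1 L) a 0 *: v = row a (trim_gens *m d1 L) *m v.
    by apply: in_sqMr; rewrite rowE; apply: in_sqMl.
  by rewrite [row a _]mx11_scalar mul_scalar_mx [row a _ 0 0]mxE.
(* [w *m curl_mx] is in m^2 as soon as the product in F vanishes modulo m *)
have hA a b : map_mx pi (gen a ** gen b) = 0 -> map_mx pi (rsubmx (M a b)) = 0.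
  move=> h; apply: in_sq_curl_mx.
  have -> : rsubmx (M a b) *m curl_mx = (trim_gens *m d1 L) a 0 *: delta_mx 0 b
        - (trim_gens *m d1 L) b 0 *: delta_mx 0 a - (gen a ** gen b) *m Q.
    by rewrite -dM -{2}[M a b]hsubmxK mul_row_col lM addrC addKr.
  by apply: in_sqB; [apply: in_sqB; apply: sq_aug|apply: in_sqM].
have lM11 u v : lsubmx (bil M u v) = (u *m trim_gens) ** (v *m trim_gens).
  rewrite bil_mulmxl {1}/bil linear_sum; apply: eq_bigr => a _.
  rewrite linear_sum bil_mulmxr scaler_sumr; apply: eq_bigr => b _.
  by rewrite linearZ /= lM scalerA.
(* T maps multiplicatively to F: compare the [F_2] components of the two Leibniz rules and cancel
   the injective [d3] of F. *)
have y1 a c : lsubmx (bil M12 (delta_mx 0 a) c) = bil (@m12 R L) (gen a) (lsubmx c).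
  apply: (d3_inj hL); rewrite leib12 //.
  have := leib12 hT (delta_mx 0 a) c; rewrite /= -{1}[bil M12 _ _]hsubmxK.
  rewrite mul_row_block mulmx0 addr0 => /(congr1 lsubmx); rewrite row_mxKl => ->.
  rewrite linearB linearZ /= lM11 -rowE; congr (_ *: _ - _ ** _).
    by rewrite /aug /= mulmxA -rowE.
  by rewrite -mulmxA mul_col_mx hQ curl_gens0 -{1}[c]hsubmxK mul_row_col mulmx0 addr0.
split=> //.
- move=> a b; exists (rsubmx (M a b)); first by rewrite -lM hsubmxK.
  exact: hA.
move=> a c; exists (rsubmx (bil M12 (delta_mx 0 a) c)); first by rewrite -y1 hsubmxK.
(* The [K_2] component of the Leibniz rule expresses the gradient of the Koszul component; each of
   its terms is now shown to lie in m^2. *)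
move=> h; apply: in_sq_grad_mx.
have := leib12 hT (delta_mx 0 a) c; rewrite /= -{1}[bil M12 _ _]hsubmxK.
rewrite mul_row_block => /(congr1 rsubmx); rewrite row_mxKr y1 mulmxN.
move/eqP; rewrite addrC subr_eq => /eqP ->.
apply: in_sqD; last by apply: in_sqM.
rewrite linearB linearZ /=; apply: in_sqB.
  rewrite (_ : aug _ = (trim_gens *m d1 L) a 0); first exact: sq_aug.
  by rewrite /aug -rowE [LHS]mxE.
(* v is the differential of c. Its coordinates on the kept generators lie in m^2 since those of [Q]
   do; the other coordinates lie in m and multiply products with elements of m F_1, whose Koszul
   components lie in m by [hA]. *)
set v := c *m _.
have -> : rsubmx (bil M (delta_mx 0 a) v) = v *m \matrix_b rsubmx (M a b).
  rewrite bil_sumr_coef linear_sum mulmx_sum_row; apply: eq_bigr => b _.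
  by rewrite linearZ /= bil_delta rowK.
set N := \matrix_b _; rewrite -[v]hsubmxK -[N]vsubmxK mul_row_col.
have mv : map_mx pi v = 0 by rewrite map_mxM /= [map_mx pi (col_mx _ _)]mT2 mulmx0.
apply: in_sqD.
  apply: in_sqMr; rewrite /v -[c]hsubmxK mul_row_col linearD /= -!mulmx_lsub.
  apply: in_sqD; first exact: in_sqMl.
  by rewrite row_mxKl; apply/in_sqMl/in_sq0.
apply: (in_sqM pi_ker); first by rewrite map_rsubmx mv linear0.
apply/row_matrixP => i; rewrite row0 -map_row.
have -> : row i (dsubmx N) = rsubmx (M a (rshift s i)).
  by apply/rowP => j; rewrite !mxE.
by apply: hA; rewrite map_bil pi_gen_rshift bil0r.
Qed.

End Trimming.

(** * From DG resolutions and bases to matrices *)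

Section FromDG.
Variables (R : comNzRingType).

(** The column [c] reads the coordinate along the unit, which identifies [F_0] with R; vanishing of
    [F_4] makes the last differential injective. *)
Lemma dg_len3 (F : dg_data R) (J : set R) :
    dg_resolution F J -> rk F 4 = 0%N ->
  exists c : 'M[R]_(rk F 0, 1),
    (forall v : 'rV_(rk F 1), v *m dif F 1 = (v *m (dif F 1 *m c)) 0 0 *: dg_one F) /\
    len3_algebra (@Len3 R (rk F 1) (rk F 2) (rk F 3) (dif F 1 *m c) (dif F 2)
                    (dif F 3) (@tbl R F 1 1 2) (@tbl R F 1 2 3)).
Proof.
move=> [[_ difK _ mul1 _ mulC odd0 leib] resF] F4.
have [_ _ _ _ ex] := resF; have [c hc] := degree0_coord resF.
have dE (v : 'rV_(rk F 1)) :
    v *m dif F 1 = (v *m (dif F 1 *m c)) 0 0 *: dg_one F.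
  by rewrite mulmxA -hc.
have mulr1 i (x : 'rV_(rk F i)) : dg_mul F i x (dg_one F) = x.
  have := mulC i 0 x (dg_one F); rewrite muln0 expr0 scale1r addn0.
  by rewrite mul1.
have mulZl i j l a (x : 'rV_(rk F i)) (y : 'rV_(rk F j)) :
    dg_mul F l (a *: x) y = a *: dg_mul F l x y by apply: bilZl.
have mulZr i j l a (x : 'rV_(rk F i)) (y : 'rV_(rk F j)) :
    dg_mul F l x (a *: y) = a *: dg_mul F l x y by apply: bilZr.
exists c; split=> //; split; first split=> /=.
- by rewrite mulmxA difK mul0mx.
- exact: difK.
- by move=> v hv; apply: (ex 0); rewrite dE hv mxE scale0r.
- exact: ex.
- move=> v hv; have [w ->] := ex 2 v hv.
  by move: w (dif F 4); rewrite F4 => w D; rewrite (thinmx0 w) mul0mx.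
- by move=> x; apply: (odd0 1).
- move=> x y; rewrite /aug /=; have := leib 1 1 x y.
  by rewrite !dE mulZl mulZr mul1 mulr1 expr1 scaleN1r.
- move=> x y; rewrite /aug /=; have := leib 1 2 x y.
  by rewrite dE mulZl mul1 expr1 scaleN1r.
Qed.

(** No equality of [n] and [N] is required: existence of coordinates gives a left inverse, and
    uniqueness, applied to the rows of P, makes it a right inverse. *)
Lemma is_basis_inv N n (f : 'I_n -> 'rV[R]_N) : is_basis f ->
  exists P' : 'M_(N, n),
    P' *m (\matrix_i f i) = 1%:M /\ (\matrix_i f i) *m P' = 1%:M.
Proof.
move=> hf; set P := \matrix_i f i.
have hP (v : 'rV_N) : exists! c, v = c *m P.
  have [c [hc uc]] := hf v; have E c' : c' *m P = \sum_i c' 0 i *: f i.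
    by rewrite mulmx_sum_row; apply: eq_bigr => i _; rewrite rowK.
  by exists c; split=> [|c']; rewrite E //; apply: uc.
have [P' hP'] : exists P', 1%:M = P' *m P.
  by apply: mx_factor => i; have [c [hc _]] := hP (row i 1%:M); exists c.
exists P'; split=> //; apply/row_matrixP => i.
have [c [_ uc]] := hP (row i P).
rewrite -(uc (row i (P *m P'))) ?(uc (row i 1%:M)) //.
  by rewrite -row_mul mul1mx.
by rewrite -row_mul -mulmxA -hP' mulmx1.
Qed.

End FromDG.

Section BaseChange.
Variables (R : comNzRingType) (k : fieldType) (pi : {rmorphism R -> k}).

Lemma dg_mul_base_change (A : dg_data R) i j l (x : 'rV_(rk A i)) (y : 'rV_(rk A j)) :
  @dg_mul k (base_change pi A) i j l (map_mx pi x) (map_mx pi y) =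
  map_mx pi (dg_mul A l x y).
Proof. by rewrite map_bil. Qed.

Lemma homologousE (A : dg_data R) l (x y : 'rV[k]_(rk A l)) :
  map_mx pi (dif A l.+1) = 0 -> @homologous k (base_change pi A) l x y <-> x = y.
Proof.
move=> h; split=> [[w]|->]; last by exists 0; rewrite mul0mx subrr.
by rewrite /= h mulmx0 => /eqP; rewrite subr_eq0 => /eqP.
Qed.

(** Over [k] every element is a cycle and the only boundary is 0, so a homology basis is just a
    basis of the module. *)
Lemma minimal_homology_basis (A : dg_data R) l N (Z : 'M[R]_(N, rk A l))
    (Z' : 'M[R]_(rk A l, N)) :
    map_mx pi (dif A l) = 0 -> map_mx pi (dif A l.+1) = 0 ->
    Z *m Z' = 1%:M -> Z' *m Z = 1%:M ->
  @homology_basis k (base_change pi A) l N (fun a => map_mx pi (row a Z)).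
Proof.
move=> m1 m2 ZZ' Z'Z; split=> [a|v _]; first by rewrite /= m1 mulmx0.
have E (c : 'rV_N) : \sum_a c 0 a *: map_mx pi (row a Z) = c *m map_mx pi Z.
  by rewrite mulmx_sum_row; apply: eq_bigr => a _; rewrite map_row.
exists (v *m map_mx pi Z'); split.
  by apply/homologousE => //; rewrite E -mulmxA -map_mxM Z'Z map_mx1 mulmx1.
move=> c /homologousE -/(_ m2); rewrite E => ->.
by rewrite -mulmxA -map_mxM ZZ' map_mx1 mulmx1.
Qed.

End BaseChange.

(** * Renumbering the elements of a subset *)

Section Finite.

(** [enum A] is increasing, so a position counts the smaller members. This locates the kept
    generators with respect to [p] after trimming. *)
Lemma card_lt_enum_val n (A : {set 'I_n}) (i : 'I_#|A|) :
  #|[set y in A | (y < enum_val i)%N]| = i.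
Proof.
have sA : sorted <%O (map val (enum A)).
  rewrite -[enum _](eq_filter (mem_enum _)).
  rewrite -(eq_filter (mem_map val_inj _)) -filter_map.
  rewrite (sorted_filter Order.POrderTheory.lt_trans) // unlock val_ord_enum.
  exact: iota_ltn_sorted.
have hi : (i < size (map val (enum A)))%N by rewrite size_map -cardE.
rewrite -[RHS](Order.POrderTheory.count_lt_nth 0%N sA hi) count_map.
rewrite (nth_map (enum_val i)) -?cardE // -(enum_val_nth (enum_val i)).
rewrite cardE -size_filter; apply: perm_size; apply: uniq_perm.
- exact: enum_uniq.
- by rewrite filter_uniq ?enum_uniq.
by move=> y; rewrite mem_enum inE mem_filter mem_enum andbC.
Qed.

Lemma enum_val_lt n (A : {set 'I_n}) (p : nat) (i : 'I_#|A|) :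
  (enum_val i < p)%N = (i < #|[set y in A | (y < p)%N]|)%N.
Proof.
rewrite -[X in _ = (X < _)%N](card_lt_enum_val i); case: ltnP => hp; symmetry.
  apply/proper_card/properP; split.
    apply/fintype.subsetP => y; rewrite !inE => /andP[-> h].
    exact: ltn_trans h hp.
  by exists (enum_val i); rewrite !inE ?enum_valP ?hp // ltnn andbF.
apply/negbTE; rewrite -leqNgt; apply/subset_leq_card/fintype.subsetP => y.
by rewrite !inE => /andP[-> h]; apply: leq_trans hp.
Qed.

Lemma enum_val_eq n (A : {set 'I_n}) (p : 'I_n) (i : 'I_#|A|) : p \in A ->
  enum_val i = p <-> i = #|[set y in A | (y < p)%N]| :> nat.
Proof.
move=> pA; have [j ->] : exists j : 'I_#|A|, p = enum_val j.
  by exists (enum_rank_in pA p); rewrite (enum_rankK_in pA pA).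
rewrite card_lt_enum_val.
by split=> [/enum_val_inj->|/val_inj->].
Qed.

Lemma card_ord_lt n m : (m <= n)%N -> #|[set y : 'I_n | (y < m)%N]%SET| = m.
Proof. by move=> h; rewrite -sum1dep_card (big_ord_narrow h) sum1_card card_ord. Qed.

Lemma extend_injection r N (g : 'I_r -> 'I_N) : injective g ->
  exists2 f : 'I_N -> 'I_N, injective f &
    forall (i : 'I_r) (j : 'I_N), i = j :> nat -> f j = g i.
Proof.
move=> gi; pose w := codom g ++ enum [predC codom g].
have sw : size w = N.
  by rewrite size_cat -cardE -(card_uniqP _) ?cardC ?card_ord //; apply/injectiveP.
have uw : uniq w.
  rewrite cat_uniq enum_uniq andbT; apply/andP; split; first exact/injectiveP.
  by apply/hasPn => y; rewrite mem_enum inE.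
exists (fun j => nth j w j) => [i j|i j hij].
  rewrite (set_nth_default i) ?sw // => /eqP.
  by rewrite nth_uniq ?sw // => /eqP /val_inj.
rewrite nth_cat size_codom card_ord -hij ltn_ord.
by rewrite (nth_map i) ?size_enum_ord // nth_ord_enum.
Qed.

End Finite.

(** * Trimmed ideals *)

Section SubRows.
Variables (R : comNzRingType) (n N : nat) (P : 'M[R]_(n, N)) (P' : 'M[R]_(N, n)).
Implicit Types S : {set 'I_n}.

Definition subrows S : 'M[R]_(#|S|, N) := rowsub (fun i : 'I_#|S| => enum_val i) P.
Definition subcols S : 'M[R]_(N, #|S|) := colsub (fun i : 'I_#|S| => enum_val i) P'.

Lemma row_subrows S i : row i (subrows S) = row (enum_val i) P.
Proof. exact: row_rowsub. Qed.

Lemma subrows_subcols S : P *m P' = 1%:M -> subrows S *m subcols S = 1%:M.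
Proof.
move=> h; rewrite mul_rowsub_mx mulmx_colsub h.
by apply/matrixP => i j; rewrite !mxE (inj_eq enum_val_inj).
Qed.

Lemma subrows_subcols0 S S' : P *m P' = 1%:M -> {in S, forall i, i \notin S'} ->
  subrows S *m subcols S' = 0.
Proof.
move=> h dS; rewrite mul_rowsub_mx mulmx_colsub h.
apply/matrixP => i j; rewrite !mxE; case: eqP => // e.
by have := dS _ (enum_valP i); rewrite e enum_valP.
Qed.

Lemma subcols_subrows S : P' *m P = 1%:M ->
  subcols (~: S) *m subrows (~: S) + subcols S *m subrows S = 1%:M.
Proof.
move=> <-; apply/matrixP => a b; rewrite !mxE.
rewrite [RHS](bigID (mem S)) /= addrC; congr (_ + _).
  rewrite [RHS](big_enum_val (fun j => P' a j * P j b)).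
  by apply: eq_bigr => i _; rewrite !mxE.
rewrite (eq_bigl (fun i => i \in ~: S)) => [|i]; last by rewrite !inE.
rewrite [RHS](big_enum_val (fun j => P' a j * P j b)).
by apply: eq_bigr => i _; rewrite !mxE.
Qed.

End SubRows.

Section Ideals.
Variables (R : comNzRingType) (k : fieldType) (pi : {rmorphism R -> k}).
Variables (x1 x2 x3 : R) (m : set R).
Hypothesis pi_ker : forall r,
  pi r = 0 <-> exists c1 c2 c3, r = x1 * c1 + x2 * c2 + x3 * c3.
Hypothesis pi_m : forall r : R, pi r = 0 <-> m r.
Local Notation in_sq := (in_sq x1 x2 x3 pi).

Lemma ideal_gen_min (S J : set R) : is_ideal J -> S `<=` J -> ideal_gen S `<=` J.
Proof.
move=> [J0 JD JM] SJ r [n [c [s [hs ->]]]].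
by elim/big_ind: _ => // i _; apply/JM/SJ.
Qed.

Lemma ideal_gen_sub (S : set R) : S `<=` ideal_gen S.
Proof.
move=> r hr; exists 1%N, (fun _ => 1), (fun _ => r); split=> //.
by rewrite big_ord1 mul1r.
Qed.

Lemma in_sqP a b (A : 'M[R]_(a, b)) :
  in_sq A <-> forall i j, idealM m m (A i j).
Proof.
have [e1 e2 e3] := pi_x pi_ker.
split=> [[A1 [A2 [A3 [-> h1 h2 h3]]]] i j|hA].
  have hm (B : 'M[R]_(a, b)) : map_mx pi B = 0 -> m (B i j).
    by move=> /matrixP/(_ i j); rewrite !mxE => /pi_m.
  exists 3, (fun _ => 1),
    (fun l => [:: x1 * A1 i j; x2 * A2 i j; x3 * A3 i j]`_l).
  split; last by rewrite !big_ord_recl big_ord0 /= !mul1r !mxE addr0 addrA.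
  case; case=> [|[|[|]]] //= _.
  - by exists x1, (A1 i j); split=> //; [exact/pi_m|exact: hm].
  - by exists x2, (A2 i j); split=> //; [exact/pi_m|exact: hm].
  - by exists x3, (A3 i j); split=> //; [exact/pi_m|exact: hm].
have /fin_all_exists[w hw] : forall ij : 'I_a * 'I_b, exists w : R * R * R,
    [/\ A ij.1 ij.2 = x1 * w.1.1 + x2 * w.1.2 + x3 * w.2,
        pi w.1.1 = 0, pi w.1.2 = 0 & pi w.2 = 0].
  move=> ij; have [l [c [s [hs ->]]]] := hA ij.1 ij.2.
  have : in_sq (\sum_i (c i)%:M *m (s i)%:M : 'M[R]_1).
    apply: in_sq_sum => i; apply: in_sqMl; have [u [v [hu hv ->]]] := hs i.
    rewrite scalar_mxM; apply: (in_sqM pi_ker).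
      by rewrite map_scalar_mx /= (proj2 (pi_m u)) // -scalemx1 scale0r.
    by rewrite map_scalar_mx /= (proj2 (pi_m v)) // -scalemx1 scale0r.
  move=> [A1 [A2 [A3 [h /matrixP/(_ 0 0) h1 /matrixP/(_ 0 0) h2]]]].
  move=> /matrixP/(_ 0 0) h3.
  rewrite !mxE in h1 h2 h3.
  exists (A1 0 0, A2 0 0, A3 0 0); split=> //=.
  move/matrixP/(_ 0 0): h; rewrite summxE !mxE => <-.
  by apply: eq_bigr => i _; rewrite -scalar_mxM mxE eqxx.
exists (\matrix_(i, j) (w (i, j)).1.1), (\matrix_(i, j) (w (i, j)).1.2),
  (\matrix_(i, j) (w (i, j)).2).
by split; apply/matrixP => i j; rewrite !mxE; have [] := hw (i, j).
Qed.

Lemma aug_subrows (L : len3 R) n (P : 'M[R]_(n, l1 L)) (phi : 'I_n -> R) (S : {set 'I_n})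
    (v : 'rV_#|S|) :
    (forall i, aug (row i P) = phi i) ->
  aug (v *m subrows P S) = \sum_i v 0 i * phi (enum_val i).
Proof.
move=> hphi; rewrite /aug [v *m _]mulmx_sum_row mulmx_suml summxE.
apply: eq_bigr => i _; rewrite row_subrows -scalemxAl mxE.
by rewrite -[X in _ * X]/(aug (row (enum_val i) P)) hphi.
Qed.

(** The rows of [trim_gens] are sent by [d1] to the kept [phi_i] and to the products [x_l phi_j]
    with j trimmed, which generate the trimmed ideal. *)
Lemma trimmingP (L : len3 R) n (P : 'M[R]_(n, l1 L)) (phi : 'I_n -> R)
    (sigma : {set 'I_n}) :
    (forall i, aug (row i P) = phi i) ->
  forall r, trimming m phi sigma r <-> exists y,
    aug (y *m trim_gens x1 x2 x3 (subrows P (~: sigma)) (subrows P sigma)) = r.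
Proof.
move=> hphi r; set E := trim_gens _ _ _ _ _.
have augE V0 V1 V2 V3 : aug (row_mx V0 (row_mx V1 (row_mx V2 V3)) *m E) =
    \sum_i V0 0 i * phi (enum_val i) +
    \sum_i (x1 * V1 0 i + x2 * V2 0 i + x3 * V3 0 i) * phi (enum_val i).
  rewrite mul_trim_gens augD !(aug_subrows _ hphi); congr (_ + _).
  by apply: eq_bigr => i _; rewrite !mxE.
pose I := [set r | exists y, aug (y *m E) = r].
have I_ideal : is_ideal I.
  split=> [|_ _ [y <-] [z <-]|c _ [y <-]].
  - by exists 0; rewrite mul0mx /aug mul0mx mxE.
  - by exists (y + z); rewrite mulmxDl augD.
  - by exists (c *: y); rewrite -scalemxAl augZ.
have [_ ID IM] := I_ideal.
split=> [[r1 [r2 [h1 h2 ->]]]|[y <-]].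
  apply: (ID r1 r2).
    apply: (ideal_gen_min I_ideal) h1 => _ [i /= hi <-].
    have hi' : i \in ~: sigma by rewrite inE.
    pose j := enum_rank_in hi' i.
    exists (row_mx (delta_mx 0 j) 0).
    rewrite -!row_mx0 augE (bigD1 j) //= mxE !eqxx mul1r enum_rankK_in //.
    rewrite !big1 ?addr0 // => [l _|l /negPf hl].
      by rewrite !mxE !mulr0 !addr0 mul0r.
    by rewrite mxE eqxx hl mul0r.
  apply: (ideal_gen_min I_ideal) h2 => _ [u [v [hu hv ->]]].
  (* The colon ideal of [I] by [u]: as it is an ideal, [v] may be taken to be one of the generators
     [phi_i]. *)
  pose I' := [set v | I (u * v)].
  have I'_ideal : is_ideal I'.
    split=> [|a b ha hb|c a ha].
    - by change (I (u * 0)); rewrite mulr0; have [] := I_ideal.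
    - by change (I (u * (a + b))); rewrite mulrDr; exact: (ID (u * a) (u * b)).
    - by change (I (u * (c * a))); rewrite mulrCA; exact: (IM c (u * a) ha).
  apply: (ideal_gen_min I'_ideal) hv => _ [i /= hi <-].
  change (I (u * phi i)).
  have [c1 [c2 [c3 ->]]] := (pi_ker u).1 ((pi_m u).2 hu).
  pose j := enum_rank_in hi i.
  exists (row_mx 0 (row_mx (c1 *: delta_mx 0 j)
    (row_mx (c2 *: delta_mx 0 j) (c3 *: delta_mx 0 j)))).
  rewrite augE big1 => [|l _]; last by rewrite mxE mul0r.
  rewrite add0r (bigD1 j) //= big1 => [|l /negPf hl]; last first.
    by rewrite !mxE eqxx hl !mulr0 !addr0 mul0r.
  by rewrite !mxE !eqxx !mulr1 enum_rankK_in // addr0.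
have [V0 [V1 [V2 [V3 ->]]]] := row4P y; rewrite augE.
eexists; eexists; split; last reflexivity.
  exists #|~: sigma|, (fun i => V0 0 i), (fun i => phi (enum_val i)); split=> // i.
  by exists (enum_val i) => //=; have := enum_valP i; rewrite inE.
exists #|sigma|, (fun _ => 1),
  (fun i => (x1 * V1 0 i + x2 * V2 0 i + x3 * V3 0 i) * phi (enum_val i)).
split=> [i|]; last by apply: eq_bigr => i _; rewrite mul1r.
exists (x1 * V1 0 i + x2 * V2 0 i + x3 * V3 0 i), (phi (enum_val i)); split=> //.
  by apply/pi_m/pi_ker; exists (V1 0 i), (V2 0 i), (V3 0 i).
by apply: ideal_gen_sub; exists (enum_val i) => //=; apply: enum_valP.
Qed.

End Ideals.

(** * Products modulo m *)

Section MinimalLength3.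
Variables (R : comNzRingType) (k : fieldType) (pi : {rmorphism R -> k}).
Variable T : len3 R.
Hypotheses (mT1 : map_mx pi (d1 T) = 0) (mT2 : map_mx pi (d2 T) = 0)
  (mT3 : map_mx pi (d3 T) = 0).

Lemma dg3_minimal i : map_mx pi (dif (dg3 T) i) = 0.
Proof. by case: i => [|[|[|[|i]]]] //=; exact: map_mx0. Qed.

(** With zero differentials and zero products in positive degrees, a Massey operation may vanish on
    all words of length at least 2. *)
Lemma trivial_massey_of_trivial_products :
    (forall a b, map_mx pi (@m11 R T a b) = 0) ->
    (forall a b, map_mx pi (@m12 R T a b) = 0) ->
  @trivial_massey_operation k (base_change pi (dg3 T)).
Proof.
move=> h11 h12; set A := base_change pi (dg3 T).
have prod0 i j l (x : 'rV_(rk A i)) (y : 'rV_(rk A j)) :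
    (0 < i)%N -> (0 < j)%N -> dg_mul A l x y = 0.
  move=> hi hj; rewrite /dg_mul big1 // => a _; rewrite big1 // => b _.
  suff -> : tbl l a b = 0 by rewrite scaler0.
  move: i j l {x y} hi hj a b.
  move=> [|[|[|[|i]]]] [|[|[|[|j]]]] [|[|[|[|l]]]] // _ _ a b;
    by rewrite /= ?map_mx0.
pose h i := rk (dg3 T) i.+1.
pose z i (a : 'I_(h i)) : 'rV[k]_(rk A i.+1) := map_mx pi (row a 1%:M).
(* A one-letter word goes to its basis vector. Comparing degree and index as natural numbers defines
   this for every target degree without a transport. *)
pose mu (w : seq {i : nat & 'I_(h i)}) l : 'rV[k]_(rk A l) :=
  if w is [:: c] then
    \row_(b < rk (dg3 T) l)
      (((tag c).+1 == l :> nat)%:R * (val (tagged c) == val b)%:R)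
  else 0.
exists h, z, mu; split=> [i|i a|w hw].
- by apply: (minimal_homology_basis (Z' := 1%:M)); rewrite ?mulmx1 // dg3_minimal.
- by apply/rowP => b; rewrite !mxE eqxx mul1r /= -val_eqE rmorph_nat.
have -> : mu w (massey_deg w) = 0 by case: w hw => [|c [|]].
rewrite mul0mx big_seq big1 // => j; rewrite mem_index_iota => /andP[j1 j2].
have deg_gt0 (u : seq {i : nat & 'I_(h i)}) :
    (0 < size u)%N -> (0 < massey_deg u)%N.
  by case: u => // c u _; rewrite /massey_deg big_cons !addSn.
rewrite prod0 ?scaler0 //; apply: deg_gt0.
  by rewrite size_take j2.
by rewrite size_drop subn_gt0.
Qed.

End MinimalLength3.

Section Unipotent.
Variable R : comNzRingType.

(** Adding Koszul components to a basis of F, and completing it by the Koszul basis, gives a basis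
    of T. *)
Lemma unipotent_block_inv n N t (P : 'M[R]_(n, N)) (P' : 'M_(N, n)) (K : 'M_(n, t)) :
    P *m P' = 1%:M -> P' *m P = 1%:M ->
  exists Z', block_mx P K 0 1%:M *m Z' = 1%:M /\ Z' *m block_mx P K 0 1%:M = 1%:M.
Proof.
move=> h1 h2; exists (block_mx P' (- (P' *m K)) 0 1%:M).
rewrite !mulmx_block !mulmx0 !mul0mx !mul1mx !mulmx1 !addr0 !add0r h1 h2.
rewrite mulmxN mulmxA h1 mul1mx addNr subrr.
by rewrite -!scalar_mx_block.
Qed.

Lemma rowsub_inv n N (P : 'M[R]_(n, N)) (P' : 'M_(N, n)) (f : 'I_n -> 'I_n) :
    injective f -> P *m P' = 1%:M -> P' *m P = 1%:M ->
  rowsub f P *m colsub f P' = 1%:M /\ colsub f P' *m rowsub f P = 1%:M.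
Proof.
move=> fi h1 h2; split.
  rewrite mul_rowsub_mx mulmx_colsub h1.
  by apply/matrixP => i j; rewrite !mxE (inj_eq fi).
rewrite -h2; apply/matrixP => i j; rewrite !mxE [RHS](reindex_inj fi) /=.
by apply: eq_bigr => l _; rewrite !mxE.
Qed.

End Unipotent.

Section TrimmedTable.
Variables (R : comNzRingType) (k : fieldType) (pi : {rmorphism R -> k}).
Variables (x1 x2 x3 : R).
Hypothesis pi_ker : forall r,
  pi r = 0 <-> exists c1 c2 c3, r = x1 * c1 + x2 * c2 + x3 * c3.
Variables (L : len3 R) (n n2 n3 : nat).
Variables (P1 : 'M[R]_(n, l1 L)) (P2 : 'M[R]_(n2, l2 L)) (P3 : 'M[R]_(n3, l3 L)).
Variables (P2' : 'M[R]_(l2 L, n2)) (P3' : 'M[R]_(l3 L, n3)).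
Hypotheses (P22' : P2 *m P2' = 1%:M) (P2'2 : P2' *m P2 = 1%:M).
Hypotheses (P33' : P3 *m P3' = 1%:M) (P3'3 : P3' *m P3 = 1%:M).
Local Notation "x ** y" := (bil (@m11 R L) x y) (at level 40).
Local Notation "x *** y" := (bil (@m12 R L) x y) (at level 40).

Variables (p : 'I_n) (q : nat).
Hypotheses (hq2 : (p + q <= n2)%N) (hq3 : (q <= n3)%N).
Hypothesis tab11 : forall (j : 'I_n) (l : 'I_n2), (j < p)%N -> l = j :> nat ->
  map_mx pi (row p P1 ** row j P1) = map_mx pi (row l P2).
Hypothesis tab11_0 : forall i j : 'I_n,
  ~ (i = p /\ (j < p)%N) -> ~ (j = p /\ (i < p)%N) ->
  map_mx pi (row i P1 ** row j P1) = 0.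
Hypothesis tab12 : forall (j : 'I_n2) (l : 'I_n3), (l < q)%N ->
  j = (p + l)%N :> nat ->
  map_mx pi (row p P1 *** row j P2) = map_mx pi (row l P3).
Hypothesis tab12_0 : forall (i : 'I_n) (j : 'I_n2),
  ~ (i = p /\ (p <= j < p + q)%N) -> map_mx pi (row i P1 *** row j P2) = 0.

Variable sigma : {set 'I_n}.
Local Notation s := #|~: sigma|.
Local Notation t := #|sigma|.
Local Notation E := (trim_gens x1 x2 x3 (subrows P1 (~: sigma)) (subrows P1 sigma)).

Lemma row_gens_l (i : 'I_s) : row (lshift _ i) E = row (enum_val i) P1.
Proof. by rewrite rowKu row_subrows. Qed.

Lemma pi_mul12 (i : 'I_n) c : i <> p -> map_mx pi (row i P1 *** c) = 0.
Proof.
move=> hi; rewrite -[c]mulmx1 -P2'2 mulmxA bil_mulmxr raddf_sum big1 // => j _.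
by rewrite /= map_mxZ /= tab12_0 ?scaler0 // => -[].
Qed.

Lemma pi_gens11_sigma a b : p \in sigma -> map_mx pi (row a E ** row b E) = 0.
Proof.
move=> pS; have np (i : 'I_s) : enum_val i <> p.
  by move=> e; have := enum_valP i; rewrite e inE pS.
rewrite -[a]splitK -[b]splitK; case: (split a) => i; last first.
  by rewrite map_bil pi_gen_rshift // bil0l.
case: (split b) => j; last by rewrite map_bil pi_gen_rshift // bil0r.
rewrite /= !row_gens_l; apply: tab11_0 => -[e _]; exact: np e.
Qed.

Lemma pi_gens12_sigma a c : p \in sigma -> map_mx pi (row a E *** c) = 0.
Proof.
move=> pS; have np (i : 'I_s) : enum_val i <> p.
  by move=> e; have := enum_valP i; rewrite e inE pS.
rewrite -[a]splitK; case: (split a) => i; last first.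
  by rewrite map_bil pi_gen_rshift // bil0l.
by rewrite /= row_gens_l pi_mul12.
Qed.

Variables (Q : 'M[R]_(l2 L, s + (t + (t + t)))) (Q3 : 'M[R]_(l3 L, t + (t + t))).
Variables (M11 : 'I_(s + (t + (t + t))) -> 'I_(s + (t + (t + t))) ->
             'rV[R]_(l2 L + (t + (t + t))))
  (M12 : 'I_(s + (t + (t + t))) -> 'I_(l2 L + (t + (t + t))) -> 'rV[R]_(l3 L + t)).
Let T := trim_len3 x1 x2 x3 (subrows P1 (~: sigma)) (subrows P1 sigma) Q Q3 M11 M12.
Hypotheses (mT1 : map_mx pi (d1 T) = 0) (mT2 : map_mx pi (d2 T) = 0)
  (mT3 : map_mx pi (d3 T) = 0).
Hypothesis hM11 : forall a b, exists2 w, M11 a b = row_mx (row a E ** row b E) w &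
  (map_mx pi (row a E ** row b E) = 0 -> map_mx pi w = 0).
Hypothesis hM12 : forall a c, exists2 w,
  bil M12 (delta_mx 0 a) c = row_mx (row a E *** lsubmx c) w &
  (map_mx pi (row a E *** lsubmx c) = 0 -> map_mx pi w = 0).

Lemma pi_M11_0 a b : map_mx pi (row a E ** row b E) = 0 -> map_mx pi (M11 a b) = 0.
Proof.
by have [w -> hw] := hM11 a b => h; rewrite map_row_mx h hw // row_mx0.
Qed.

Lemma pi_M12_0 a c : map_mx pi (row a E *** lsubmx c) = 0 ->
  map_mx pi (bil M12 (delta_mx 0 a) c) = 0.
Proof.
by have [w -> hw] := hM12 a c => h; rewrite map_row_mx h hw // row_mx0.
Qed.

Lemma trimmed_trivial_massey : p \in sigma ->
  @trivial_massey_operation k (base_change pi (dg3 T)).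
Proof.
move=> pS; apply: trivial_massey_of_trivial_products => //= a b.
  by apply/pi_M11_0/pi_gens11_sigma.
by rewrite -bil_delta; apply/pi_M12_0/pi_gens12_sigma.
Qed.

Local Notation r := #|[set y in ~: sigma | (y < p)%N]|.

(** The new bases are chosen so that the surviving products are basis elements on the nose modulo m:
    the old vectors, reordered in degree 2, each with the Koszul component of the product that it
    has to equal. *)
Lemma trimmed_table_H : p \notin sigma ->
  exists (n1' n2' n3' : nat)
    (z1 : 'I_n1' -> 'rV[k]_(rk (base_change pi (dg3 T)) 1))
    (z2 : 'I_n2' -> 'rV[k]_(rk (base_change pi (dg3 T)) 2))
    (z3 : 'I_n3' -> 'rV[k]_(rk (base_change pi (dg3 T)) 3)),
  [/\ homology_basis z1, homology_basis z2, homology_basis z3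
    & table_H r q z1 z2 z3].
Proof.
move=> pS; have pN : p \in ~: sigma by rewrite inE.
pose e (i : 'I_s) := enum_val i.
(* The kept generators retain their order, so [f_p] gets the index [r], the number of kept
   generators before it. *)
pose sp := enum_rank_in pN p.
have esp : e sp = p by rewrite /e (enum_rankK_in pN pN).
have vsp : sp = r :> nat by apply/enum_val_eq.
have e_eq i : e i = p -> i = sp by rewrite -esp => /enum_val_inj.
have e_lt i : (e i < p)%N = (i < r)%N by apply: enum_val_lt.
have rs : (r < s)%N by rewrite -vsp.
(* the Koszul components of the products with f_p, to be added to f_2 *)
have /fin_all_exists[K hK] : forall a : 'I_n2, exists w, forall j : 'I_s,
    j = a :> nat -> w = rsubmx (M11 (lshift _ sp) (lshift _ j)).
  move=> a; case: (ltnP a s) => ha.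
    exists (rsubmx (M11 (lshift _ sp) (lshift _ (Ordinal ha)))) => j ja.
    by congr (rsubmx (M11 _ (lshift _ _))); apply: val_inj.
  by exists 0 => j ja; move: ha; rewrite -ja leqNgt ltn_ord.
(* New order of [f_2]: first the indices [e l] of the surviving products in degree 2, then the [q]
   indices from [p] on, shifted down to start at [r]. *)
have /fin_all_exists[g hg] : forall l : 'I_(r + q), exists y : 'I_n2,
    (forall j : 'I_s, j = l :> nat -> (l < r)%N -> y = e j :> nat) /\
    ((r <= l)%N -> y = (p + (l - r))%N :> nat).
  move=> l; case: (ltnP l r) => hl.
    have hls : (l < s)%N := ltn_trans hl rs.
    have hy : (e (Ordinal hls) < n2)%N.
      by apply: leq_trans (leq_trans (leq_addr q p) hq2); rewrite e_lt.
    exists (Ordinal hy); split=> [j jl _|//].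
    by congr (nat_of_ord (e _)); apply: val_inj.
  have hy : (p + (l - r) < n2)%N.
    apply: leq_trans hq2; rewrite ltn_add2l.
    by rewrite ltn_subLR ?ltn_ord.
  by exists (Ordinal hy); split.
have glt (l : 'I_(r + q)) : (l < r)%N -> (g l < p)%N.
  move=> hl; have [h _] := hg l.
  by rewrite (h (Ordinal (ltn_trans hl rs))) // e_lt.
have gge (l : 'I_(r + q)) : (r <= l)%N -> g l = (p + (l - r))%N :> nat by have [_] := hg l.
have ginj : injective g.
  move=> l l' gll'.
  case: (ltnP l r) (ltnP l' r) => hl [] hl'.
  - have [h _] := hg l; have [h' _] := hg l'.
    have e1 := h (Ordinal (ltn_trans hl rs)) erefl hl.
    have e2 := h' (Ordinal (ltn_trans hl' rs)) erefl hl'.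
    apply: val_inj; move: e1; rewrite gll' e2 => /val_inj/enum_val_inj.
    by move/(congr1 val).
  - by have := glt l hl; rewrite gll' gge // ltnNge leq_addr.
  - by have := glt l' hl'; rewrite -gll' gge // ltnNge leq_addr.
  - apply: val_inj; have := congr1 val gll'; rewrite /= !gge // => /addnI.
    by move/(congr1 (addn^~ r)); rewrite !subnK.
have [f finj hf] := extend_injection ginj.
have [F1 F2] := rowsub_inv finj P22' P2'2.
have [Z2' [Z2a Z2b]] := unipotent_block_inv (\matrix_a K a) F1 F2.
set Z2 := block_mx _ _ _ _ in Z2a Z2b.
have Z2l a : row (lshift _ a) Z2 = row_mx (row (f a) P2) (K a).
  by rewrite /Z2 /block_mx rowKu row_row_mx row_rowsub rowK.
have Z2r b : lsubmx (row (rshift _ b) Z2) = 0.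
  by rewrite /Z2 /block_mx rowKd row_row_mx row0 row_mxKl.
(* Likewise in degree 3: the Koszul component of the product of [f_p] with the basis vector of index
   [r + a], or 0 when that index is out of range. *)
have /fin_all_exists[K3 hK3] : forall a : 'I_n3, exists w,
    forall j : 'I_(n2 + (t + (t + t))), j = (r + a)%N :> nat ->
    w = rsubmx (bil M12 (delta_mx 0 (lshift _ sp)) (row j Z2)).
  move=> a; case: (ltnP (r + a)%N (n2 + (t + (t + t)))) => ha.
    exists (rsubmx (bil M12 (delta_mx 0 (lshift _ sp)) (row (Ordinal ha) Z2))).
    by move=> j ja; congr (rsubmx (bil M12 _ (row _ Z2))); apply: val_inj.
  by exists 0 => j ja; move: ha; rewrite -ja leqNgt ltn_ord.
have [Z3' [Z3a Z3b]] := unipotent_block_inv (\matrix_a K3 a) P33' P3'3.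
set Z3 := block_mx _ _ _ _ in Z3a Z3b.
have Z3l a : row (lshift _ a) Z3 = row_mx (row a P3) (K3 a).
  by rewrite /Z3 /block_mx rowKu row_row_mx rowK.
have dif0 := dg3_minimal mT1 mT2 mT3.
exists (s + (t + (t + t)))%N, (n2 + (t + (t + t)))%N, (n3 + t)%N.
exists (fun a => map_mx pi (row a 1%:M)), (fun a => map_mx pi (row a Z2)),
  (fun a => map_mx pi (row a Z3)).
have prod11 i j : @dg_mul k (base_change pi (dg3 T)) 1 1 2
    (map_mx pi (row i 1%:M)) (map_mx pi (row j 1%:M)) = map_mx pi (M11 i j).
  by rewrite dg_mul_base_change !row1 [X in map_mx pi X]bil_delta.
have prod12 i c : @dg_mul k (base_change pi (dg3 T)) 1 2 3
    (map_mx pi (row i 1%:M)) (map_mx pi c) = map_mx pi (bil M12 (delta_mx 0 i) c).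
  by rewrite dg_mul_base_change !row1.
have rle : (r <= p)%N.
  rewrite -[leqRHS](card_ord_lt (ltnW (ltn_ord p))); apply/subset_leq_card.
  by apply/fintype.subsetP => y; rewrite !inE => /andP[].
split.
- by apply: (minimal_homology_basis (Z' := 1%:M)); rewrite ?mulmx1 ?dif0.
- exact: (minimal_homology_basis (A := dg3 T) (l := 2) (dif0 2) (dif0 3) Z2a Z2b).
- exact: (minimal_homology_basis (A := dg3 T) (l := 3) (dif0 3) (dif0 4) Z3a Z3b).
split.
- split; first exact: ltn_addr.
    apply: leq_trans (leq_addr _ _); apply: leq_trans hq2.
    by rewrite leq_add2r.
  exact: leq_trans hq3 (leq_addr _ _).
- move=> i j l hi hj hl; apply/homologousE; first exact: dif0.
  have -> : i = lshift _ sp by apply: val_inj; rewrite /= vsp.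
  pose j' : 'I_s := Ordinal (ltn_trans hj rs).
  have -> : j = lshift _ j' by apply: val_inj.
  have hl2 : (l < n2)%N.
    by rewrite hl; apply: leq_trans hj (leq_trans rle (leq_trans (leq_addr q p) hq2)).
  have -> : l = lshift _ (Ordinal hl2) by apply: val_inj.
  rewrite prod11 Z2l; have [w E1 _] := hM11 (lshift _ sp) (lshift _ j').
  rewrite (hK (Ordinal hl2) j') // E1 row_mxKr !map_row_mx; congr row_mx.
  rewrite !row_gens_l -/(e sp) esp; apply: tab11; first by rewrite e_lt.
  pose i0 : 'I_(r + q) := Ordinal (ltn_addr q hj).
  by rewrite (hf i0) //; apply: (hg i0).1.
- move=> i j h1 h2; apply/homologousE; first exact: dif0.
  rewrite prod11; apply: pi_M11_0.
  rewrite -[i]splitK -[j]splitK; case: splitP h1 h2 => i' -> h1 h2; last first.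
    by rewrite map_bil pi_gen_rshift // bil0l.
  case: splitP h1 h2 => j' -> h1 h2; last by rewrite map_bil pi_gen_rshift // bil0r.
  rewrite /= !row_gens_l; apply: tab11_0 => -[/e_eq ei]; rewrite e_lt => hlt.
    by apply: h1; rewrite ei.
  by apply: h2; rewrite ei.
- move=> i j l hi hl hj; apply/homologousE; first exact: dif0.
  have -> : i = lshift _ sp by apply: val_inj; rewrite /= vsp.
  have hl3 : (l < n3)%N := leq_trans hl hq3.
  have -> : l = lshift _ (Ordinal hl3) by apply: val_inj.
  have hjq : (j < r + q)%N by rewrite hj ltn_add2l.
  have hj2 : (j < n2)%N.
    by apply: leq_trans hjq (leq_trans _ hq2); rewrite leq_add2r.
  rewrite prod12 Z3l (hK3 (Ordinal hl3) j) //.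
  have [w -> _] := hM12 (lshift _ sp) (row j Z2).
  rewrite row_mxKr !map_row_mx; congr row_mx.
  have -> : j = lshift _ (Ordinal hj2) by apply: val_inj.
  rewrite Z2l row_mxKl row_gens_l -/(e sp) esp; apply: tab12 => //.
  by rewrite (hf (Ordinal hjq)) // gge /= hj ?addKn ?leq_addr.
- move=> i j h; apply/homologousE; first exact: dif0.
  rewrite prod12; apply: pi_M12_0.
  rewrite -[i]splitK; case: splitP h => i' -> h; last first.
    by rewrite map_bil pi_gen_rshift // bil0l.
  rewrite -[j]splitK; case: splitP h => j' -> h; last first.
    by rewrite Z2r bil0r map_mx0.
  rewrite /= Z2l row_mxKl row_gens_l; apply: tab12_0 => -[/e_eq ei /andP[h1 h2]].
  apply: h; split; first by rewrite ei.
  (* An index from [r + q] on cannot be sent into the range from [p] to [p + q]: [f] already attains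
     those values between [r] and [r + q], and it is injective. *)
  case: (ltnP j' (r + q)) => hj; last first.
    have [d fd] : exists d, f j' = (p + d)%N :> nat.
      by exists (f j' - p)%N; rewrite subnKC.
    have hd : (r + d < r + q)%N by move: h2; rewrite fd !ltn_add2l.
    have hd2 : (r + d < n2)%N.
      by apply: leq_trans hd (leq_trans _ hq2); rewrite leq_add2r.
    have e1 : j' = Ordinal hd2.
      apply/finj/val_inj; rewrite (hf (Ordinal hd) (Ordinal hd2)) //.
      by rewrite /= gge /= ?leq_addr // addKn.
    by move: hj; rewrite e1 leqNgt hd.
  rewrite andbT leqNgt; apply/negP => hjr.
  by move: h1; rewrite (hf (Ordinal hj)) // leqNgt glt.
Qed.

End TrimmedTable.

(** * Generators of the trimmed ideal in m^2 *)

Section SquareOfMaximal.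
Variables (R : comNzRingType) (k : fieldType) (pi : {rmorphism R -> k}).
Variables (x1 x2 x3 : R).
Hypothesis pi_ker : forall r,
  pi r = 0 <-> exists c1 c2 c3, r = x1 * c1 + x2 * c2 + x3 * c3.
Local Notation in_sq := (in_sq x1 x2 x3 pi).

Lemma in_sq_col_mx a b c (A : 'M[R]_(a, c)) (B : 'M[R]_(b, c)) :
  in_sq A -> in_sq B -> in_sq (col_mx A B).
Proof.
move=> [A1 [A2 [A3 [-> a1 a2 a3]]]] [B1 [B2 [B3 [-> b1 b2 b3]]]].
exists (col_mx A1 B1), (col_mx A2 B2), (col_mx A3 B3).
by rewrite !map_col_mx a1 a2 a3 b1 b2 b3 !col_mx0 !scale_col_mx !add_col_mx.
Qed.

(* If i is kept and j is trimmed, then phi_i is the coefficient of f_j in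
   d(f_i f_j) = phi_i f_j - phi_j f_i, which lies in m^2 F_1. *)
Lemma in_sq_trim_gens (L : len3 R) n (P : 'M[R]_(n, l1 L)) (P' : 'M[R]_(l1 L, n))
    (sigma : {set 'I_n}) :
    len3_algebra L -> P *m P' = 1%:M -> map_mx pi (d1 L) = 0 -> in_sq (d2 L) ->
    sigma != finset.set0 ->
  in_sq (trim_gens x1 x2 x3 (subrows P (~: sigma)) (subrows P sigma) *m d1 L).
Proof.
move=> hL PP' m1 sq2 /finset.set0Pn[j js]; have [e1 e2 e3] := pi_x pi_ker.
rewrite !mul_col_mx -!scalemxAl.
have mB : map_mx pi (subrows P sigma *m d1 L) = 0 by rewrite map_mxM /= m1 mulmx0.
apply: in_sq_col_mx; last first.
  by do !apply: in_sq_col_mx; apply: in_sqZ2.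
set A := subrows P (~: sigma).
have -> : A *m d1 L = (A *m d1 L *m row j P - aug (row j P) *: A) *m col j P'.
  have f1 : row j P *m col j P' = 1%:M.
    rewrite colE mulmxA -row_mul PP' row1 mul_delta_mx.
    by apply/matrixP => a b; rewrite !mxE !ord1.
  have f2 : A *m col j P' = 0.
    rewrite colE mulmxA mul_rowsub_mx PP' -colE.
    apply/matrixP => a b; rewrite !mxE; case: eqP => // e.
    by have := enum_valP a; rewrite e inE js.
  by rewrite mulmxBl -scalemxAl f2 scaler0 subr0 -(mulmxA _ (row j P)) f1 mulmx1.
apply: in_sqMr.
have -> : A *m d1 L *m row j P - aug (row j P) *: A =
    (\matrix_i bil (@m11 R L) (row i A) (row j P)) *m d2 L.
  apply/row_matrixP => i; rewrite row_mul rowK leib11 // linearB linearZ /=.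
  congr (_ - _); rewrite !row_mul [row i _ *m _]mx11_scalar mul_scalar_mx.
  by [].
exact: in_sqMl.
Qed.

End SquareOfMaximal.

(** * Specialization to a regular local ring and conclusion *)

Lemma regular_generators (R : comNzRingType) (m : set R) :
    regular_local_ring m 3 ->
  exists x1 x2 x3, forall r,
    m r <-> exists c1 c2 c3, r = x1 * c1 + x2 * c2 + x3 * c3.
Proof.
move=> [_ _ _ [x ->]]; exists (x 0), (x 1), (x (lift 0 1)) => r.
split=> [|[c1 [c2 [c3 ->]]]]; last first.
  exists 3, (fun i => [:: c1; c2; c3]`_i), x; split; first by move=> i; exists i.
  rewrite !big_ord_recl big_ord0 /= addr0 addrA.
  rewrite (mulrC c1) (mulrC c2) (mulrC c3).
  by congr (_ * _ + x _ * _ + x _ * _); apply: val_inj.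
move: r; apply: ideal_gen_min; last move=> _ [i _ <-].
  split=> [|_ _ [c1 [c2 [c3 ->]]] [b1 [b2 [b3 ->]]]|a _ [c1 [c2 [c3 ->]]]].
  - by exists 0, 0, 0; ring.
  - by exists (c1 + b1), (c2 + b2), (c3 + b3); ring.
  - by exists (a * c1), (a * c2), (a * c3); ring.
case: i; case=> [|[|[|//]]] hi.
- by exists 1, 0, 0; rewrite !mulr0 !addr0 mulr1; congr x; apply: val_inj.
- by exists 0, 1, 0; rewrite !mulr0 addr0 add0r mulr1; congr x; apply: val_inj.
- by exists 0, 0, 1; rewrite !mulr0 !add0r mulr1; congr x; apply: val_inj.
Qed.

Lemma trimming_set0 (R : comNzRingType) (m : set R) n (phi : 'I_n -> R) :
  trimming m phi finset.set0 = ideal_gen (range phi).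
Proof.
have e0 : [set i | i \notin (finset.set0 : {set 'I_n})] = setT.
  by apply/seteqP; split=> i //= _; rewrite inE.
have i0 : is_ideal [set (0 : R)].
  split=> [//|_ _ -> ->|a _ ->]; first exact: addr0.
  exact: mulr0.
rewrite /trimming e0; apply/seteqP; split=> [_ [u [v [hu hv ->]]]|r hr].
  suff -> : v = 0 by rewrite addr0.
  apply: (ideal_gen_min i0) hv => _ [a [b [_ hb ->]]].
  suff -> : b = 0 by apply: mulr0.
  by apply: (ideal_gen_min i0) hb => z [i]; rewrite /= inE.
exists r, 0; rewrite addr0; split=> //.
exists 0%N, (fun _ => 0), (fun _ => 0); split; first by case.
by rewrite big_ord0.
Qed.

Lemma card_trimmed_lt n (sigma : {set 'I_n}) p : (p <= n)%N ->
  (p - #|[set i in sigma | (i < p)%N]|)%N = #|[set y in ~: sigma | (y < p)%N]|.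
Proof.
move=> hp; have := cardsID sigma [set y : 'I_n | (y < p)%N]%SET.
rewrite card_ord_lt //; set a := #|_ :&: _| => e.
have -> : #|[set i in sigma | (i < p)%N]| = a.
  by apply: eq_card => i; rewrite !inE andbC.
by rewrite -[X in (X - _)%N]e addKn; apply: eq_card => i; rewrite !inE.
Qed.

Theorem corollary4p15 (R : comNzRingType) (m : set R)
    (hR : regular_local_ring m 3)
    (k : fieldType) (pi : {rmorphism R -> k})
    (pi_surj : forall c : k, exists r : R, pi r = c)
    (pi_ker : forall r : R, pi r = 0 <-> m r)
    (n : nat) (phi : 'I_n -> R)
    (hpd : pd_quotient (ideal_gen (range phi)) 3)
    (F : dg_data R) (hF : dg_resolution F (ideal_gen (range phi)))
    (hmin : minimal m F)
    (n2 n3 : nat) (f1 : 'I_n -> 'rV[R]_(rk F 1))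
    (f2 : 'I_n2 -> 'rV[R]_(rk F 2)) (f3 : 'I_n3 -> 'rV[R]_(rk F 3))
    (hf1 : forall i : 'I_n, f1 i *m dif F 1 = phi i *: dg_one F)
    (p q : nat) (hstd : standard_form_H pi p q f1 f2 f3)
    (hprod : forall i j : 'I_n, nat_of_ord i <> p -> nat_of_ord j <> p ->
       in_ideal_mul (idealM m m) (dg_mul F 2 (f1 i) (f1 j)))
    (hd2 : forall v : 'rV[R]_(rk F 2), in_ideal_mul (idealM m m) (v *m dif F 2))
    (sigma : {set 'I_n}) :
  defines_golod pi m (trimming m phi sigma) \/
  tor_class_H pi (trimming m phi sigma)
    (p - #|[set i in sigma | (i < p)%N]|)%N q.
Proof.
have [hdg hres] := hF.
have [x1 [x2 [x3 hx]]] := regular_generators hR.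
have kerx r : pi r = 0 <-> exists c1 c2 c3, r = x1 * c1 + x2 * c2 + x3 * c3.
  by rewrite pi_ker hx.
have m0 i : map_mx pi (dif F i) = 0.
  by apply: minimal_dif_eq0 hmin => r /pi_ker.
have rk0 i : (3 < i)%N -> rk F i = 0%N.
  exact: minimal_resolution_rk_eq0 hres m0 hpd.1 i.
(* Otherwise F would be a resolution of length 2. A basis vector of [F_3] is where the Koszul chase
   starts. *)
have rk3 : (0 < rk F 3)%N.
  rewrite lt0n; apply/eqP => h3; suff /hpd.2 : pd_quotient_le (ideal_gen (range phi)) 2.
    by [].
  exists F, (dg_one F); split=> // i; rewrite leq_eqVlt => /orP[/eqP<- //|].
  exact: rk0.
have [c [hc hL]] := dg_len3 hF (rk0 4%N erefl).
set L := Len3 _ _ _ _ _ in hL.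
have sq2 : in_sq x1 x2 x3 pi (d2 L).
  apply/(in_sqP kerx pi_ker) => i j; have := hd2 (delta_mx 0 i) j.
  by rewrite -rowE mxE.
have exK a b : koszul_exact x1 x2 x3 a b.
  exact: (chase_exact kerx (d32 hL) (d21 hL) (exact1 hL) (exact2 hL) (inj3 hL)
    (m0 3%N) (Ordinal rk3)).
have m1 : map_mx pi (d1 L) = 0 by rewrite map_mxM /= m0 mul0mx.
have [b1 b2 b3 [[hp hq2 hq3] t11 t110 t12 t120]] := hstd.
have [P1' [P1a P1b]] := is_basis_inv b1; have [P2' [P2a P2b]] := is_basis_inv b2.
have [P3' [P3a P3b]] := is_basis_inv b3.
set P1 := \matrix_i f1 i in P1a P1b; set P2 := \matrix_i f2 i in P2a P2b.
set P3 := \matrix_i f3 i in P3a P3b.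
have phiE i : @aug R L (row i P1) = phi i.
  by apply: (degree0_free hres); rewrite rowK -hc hf1.
(* Nothing is trimmed when sigma is empty, and F itself shows the class. From then on a trimmed
   index exists, which puts the kept [phi_i] in m^2. *)
have [->|sN] := eqVneq sigma finset.set0.
  right; rewrite trimming_set0 (_ : #|_| = 0%N); last first.
    by apply: eq_card0 => i; rewrite !inE.
  rewrite subn0; split=> //; exists F; split=> //.
  have [E1 [E2 E3]] : f1 = (fun a => row a P1) /\ f2 = (fun a => row a P2) /\
      f3 = (fun a => row a P3).
    by do !split; apply/funext => a; rewrite rowK.
  exists n, n2, n3, (fun i => map_mx pi (f1 i)), (fun i => map_mx pi (f2 i)),
    (fun i => map_mx pi (f3 i)).
  split; last by have [] := hstd.
  - by rewrite E1; apply: minimal_homology_basis P1b P1a.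
  - by rewrite E2; apply: minimal_homology_basis P2b P2a.
  - by rewrite E3; apply: minimal_homology_basis P3b P3a.
have sq1 := in_sq_trim_gens kerx hL P1b m1 sq2 sN.
have dis1 : {in ~: sigma, forall i, i \notin sigma} by move=> i; rewrite inE.
have dis2 : {in sigma, forall i, i \notin ~: sigma} by move=> i; rewrite inE negbK.
have [Q [Q3 [M11 [M12]]]] := trimming_algebra kerx exK hL
  (subrows_subcols (~: sigma) P1b) (subrows_subcols sigma P1b)
  (subrows_subcols0 P1b dis1) (subrows_subcols0 P1b dis2)
  (subcols_subrows sigma P1a) sq2 (m0 3%N) sq1.
set T := trim_len3 _ _ _ _ _ _ _ _ _ => -[hT mT2 mT3 hM11 hM12].
have mT1 : map_mx pi (d1 T) = 0 := in_sq_pi kerx sq1.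
set J := trimming m phi sigma.
have hJ r : J r <-> exists y, @aug R T y = r.
  have tmP := trimmingP kerx pi_ker sigma phiE.
  split=> [/tmP[y <-]|[y <-]]; last apply/tmP;
    by exists y; rewrite /aug -mulmxA.
have resT : dg_resolution (dg3 T) J by apply: dg3_resolution.
(* T is a minimal resolution of length 3, and its last module contains [F_3], which is nonzero; a
   shorter resolution would force it to vanish. *)
have pd3 : pd_quotient J 3.
  split.
    exists (dg3 T), (dg_one (dg3 T)); split; first exact: resT.2.
    by case=> [|[|[|[|]]]].
  move=> d' hd'; rewrite leqNgt; apply/negP => hlt.
  have /= := minimal_resolution_rk_eq0 resT.2 (dg3_minimal mT1 mT2 mT3) hd' hlt.
  by move/eqP; rewrite addn_eq0 => /andP[/eqP h3 _]; rewrite h3 in rk3.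
pose p0 := Ordinal hp.
have valp (i : 'I_n) : i = p :> nat -> i = p0 by move=> e; apply: val_inj.
have tab11 (j : 'I_n) (l : 'I_n2) : (j < p0)%N -> l = j :> nat ->
    map_mx pi (bil (@m11 R L) (row p0 P1) (row j P1)) = map_mx pi (row l P2).
  move=> hj hl; have /(homologousE _ _ (m0 _)) := t11 p0 j l erefl hj hl.
  by rewrite dg_mul_base_change !rowK.
have tab110 (i j : 'I_n) : ~ (i = p0 /\ (j < p0)%N) -> ~ (j = p0 /\ (i < p0)%N) ->
    map_mx pi (bil (@m11 R L) (row i P1) (row j P1)) = 0.
  move=> h1 h2; have /(homologousE _ _ (m0 _)) : homologous _ _ := t110 i j
    (fun h => h1 (conj (valp _ h.1) h.2)) (fun h => h2 (conj (valp _ h.1) h.2)).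
  by rewrite dg_mul_base_change !rowK.
have tab12 (j : 'I_n2) (l : 'I_n3) : (l < q)%N -> j = (p0 + l)%N :> nat ->
    map_mx pi (bil (@m12 R L) (row p0 P1) (row j P2)) = map_mx pi (row l P3).
  move=> hl hj; have /(homologousE _ _ (m0 _)) := t12 p0 j l erefl hl hj.
  by rewrite dg_mul_base_change !rowK.
have tab120 (i : 'I_n) (j : 'I_n2) : ~ (i = p0 /\ (p0 <= j < p0 + q)%N) ->
    map_mx pi (bil (@m12 R L) (row i P1) (row j P2)) = 0.
  move=> h1; have /(homologousE _ _ (m0 _)) := t120 i j
    (fun h => h1 (conj (valp _ h.1) h.2)).
  by rewrite dg_mul_base_change !rowK.
(* Trimming the distinguished generator kills every product modulo m, which gives the Golod case;
   otherwise the products with kept generators and with [f_2] survive. *)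
have [pS|pS] := boolP (p0 \in sigma).
  left; split.
    move=> r /hJ[y <-]; apply: (in_sqP kerx pi_ker (y *m d1 T)).1.
    exact: in_sqMl.
  exists (dg3 T); split=> //.
  exact: (trimmed_trivial_massey (L := L) kerx P2a tab110 tab120 mT1 mT2 mT3
    hM11 hM12 pS).
right; split=> //; exists (dg3 T); split=> //.
rewrite card_trimmed_lt ?(ltnW hp) //.
exact: (trimmed_table_H (L := L) (p := p0) kerx P2b P2a P3b P3a hq2 hq3
  tab11 tab110 tab12 tab120 mT1 mT2 mT3 hM11 hM12 pS).
Qed.
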